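(* Let $B$ be a separable Banach space. For $i=1,2$ and $n\in\mathbb{N}$, let $\Pi^n_i\subseteq\mathcal{B}(B)$ be finite partitions of $B$ such that, for $i=1,2$, $$\sigma\Big(\bigcup_{n\in\mathbb{N}}\Pi^n_i\Big)=\mathcal{B}(B),\qquad \sigma(\Pi^n_i)\subseteq\sigma(\Pi^{n+1}_i)\quad\text{for all } n\in\mathbb{N}.$$ Let $p\in[1,\infty)$ and let $X,Y\in L^p(\mathbb{P},B)$ be such that $\mathbb{E}[Y|X]=X$. Define $$X_n:=\mathbb{E}[X\,|\,\sigma^n_X],\qquad Y_n:=\mathbb{E}[Y\,|\,\sigma^n_{X,Y}],$$ where $\sigma^n_X:=\sigma(X^{-1}(\Pi^n_1))$ and $\sigma^n_{X,Y}:=\sigma(X^{-1}(\Pi^n_1))\vee\sigma(Y^{-1}(\Pi^n_2))$. Then, for every $n$, $X_n$ is supported on at most $\#\Pi^n_1$ points, $Y_n$ is supported on at most $\#\Pi^n_1\cdot\#\Pi^n_2$ points, and $$\mathbb{E}[Y_n|\sigma^n_X]=\mathbb{E}[Y_n|X_n]=X_n,\qquad X_n=\mathbb{E}[X|X_n],\qquad Y_n=\mathbb{E}[Y|Y_n];$$ moreover, as $n\to\infty$, $X_n\to X$ almost surely and in $L^p$, and $Y_n\to Y$ almost surely and in $L^p$.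
   Context: $(\Omega,\mathcal{F},\mathbb{P})$ is the underlying probability space; $\mathcal{B}(B)$ is the Borel $\sigma$-algebra of $B$; $L^p(\mathbb{P},B)$ is the space of $B$-valued random variables $X$ with $\mathbb{E}\|X\|^p<\infty$; conditional expectations are in the Bochner sense and equalities between random variables are almost sure. For a partition $\Pi$ of $B$, $X^{-1}(\Pi):=\{X^{-1}(P):P\in\Pi\}$ and $\#\Pi$ is the number of elements of $\Pi$. A random variable is supported on at most $k$ points if its law is. *)

(* Defs.v *)
(* MathComp-Analysis *)
From HB Require Import structures.
From mathcomp Require Import all_boot all_order all_algebra.
From mathcomp Require Import finmap.
From mathcomp Require Import all_classical all_reals all_analysis.
Import Order.TTheory GRing.Theory Num.Theory numFieldNormedType.Exports.

Set Implicit Arguments.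
Unset Strict Implicit.
Unset Printing Implicit Defensive.

Local Open Scope classical_set_scope.
Local Open Scope ring_scope.

Definition separable_space (B : topologicalType) : Prop :=
  exists2 D : set B, countable D & dense D.

Definition borel (B : topologicalType) : set (set B) := <<s @open B >>.

Definition finite_borel_partition (B : topologicalType) (Pi : set (set B)) :
    Prop :=
  [/\ Pi `<=` @borel B, finite_set Pi & partition Pi id setT].

(* Junk value 0 when S is infinite. *)
Definition cardinal (T : choiceType) (S : set T) : nat := #|` fset_set S|%fset.

(* Sub-sigma-algebras of the underlying space are plain set systems. *)
Definition sigma_rv (T : Type) (B : topologicalType) (f : T -> B) :
    set (set T) :=
  preimage_set_system setT f (@borel B).

Definition measurable_wrt (T : Type) (B : topologicalType) (G : set (set T))
    (f : T -> B) : Prop :=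
  sigma_rv f `<=` G.

Definition sigma_join (T : Type) (G H : set (set T)) : set (set T) :=
  <<s G `|` H >>.

Section bochner.
Context {d : measure_display} {T : measurableType d} {R : realType}.
Context (P : probability T R) {B : completeNormedModType R}.

Definition borel_rv (f : T -> B) : Prop :=
  measurable_wrt (@measurable d T) f.

Definition simple_rv (s : T -> B) : Prop :=
  borel_rv s /\ finite_set (range s).

Definition simple_integral (A : set T) (s : T -> B) : B :=
  \sum_(b \in range s) fine (P (A `&` s @^-1` [set b])) *: b.

(* v is the Bochner integral of f over A; in particular f is Bochner
   integrable over A. Borel measurability is strong measurability when B is
   separable, and in general the latter follows (almost everywhere) from the
   existence of s. *)
Definition has_bochner_integral (A : set T) (f : T -> B) (v : B) : Prop :=
  borel_rv f /\
  exists s : nat -> T -> B,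
    [/\ forall n, simple_rv (s n),
        (\int[P]_(w in A) (`|f w - s n w|%R)%:E)%E @[n --> \oo] --> 0%E
      & simple_integral A (s n) @[n --> \oo] --> v].

(* Z is a version of E[X | G]; the case A = setT of the second clause
   expresses that X and Z are Bochner integrable. *)
Definition is_cond_exp (G : set (set T)) (X Z : T -> B) : Prop :=
  measurable_wrt G Z /\
  forall A, G A ->
    exists2 v : B, has_bochner_integral A X v & has_bochner_integral A Z v.

Definition in_Lp (p : R) (f : T -> B) : Prop :=
  borel_rv f /\ ('E_P[fun w => (`|f w| `^ p)%R] < +oo)%E.

Definition cvg_Lp (p : R) (f : nat -> T -> B) (g : T -> B) : Prop :=
  (forall n, in_Lp p (f n)) /\
  'E_P[fun w => (`|f n w - g w| `^ p)%R]%E @[n --> \oo] --> 0%E.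

Definition cvg_as (f : nat -> T -> B) (g : T -> B) : Prop :=
  {ae P, forall w, f n w @[n --> \oo] --> g w}.

Definition law (f : T -> B) : set B -> \bar R :=
  pushforward P (f : T -> g_sigma_algebraType (@open B)).

Definition supported_on_at_most (k : nat) (f : T -> B) : Prop :=
  exists F : set B, (F #<= `I_k)%card /\ law f F = 1%E.

End bochner.

(* Main.v *)
Require Import Defs.
From HB Require Import structures.
From mathcomp Require Import all_boot all_order all_algebra.
From mathcomp Require Import finmap.
From mathcomp Require Import all_classical all_reals all_analysis.
From mathcomp Require Import measurable_realfun ring lra.
Import Order.TTheory GRing.Theory Num.Theory numFieldNormedType.Exports.

(** The sigma-algebras sX n and sXY n come from finite partitions, so their
    members are the unions of fibres of a finite-valued map: the block of X, or
    the pair of the blocks of X and Y. Conditioning on them means averaging over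
    fibres. A version of X_n is measurable for sX n, hence constant on each
    fibre, which bounds the number of its values; likewise for Y_n. The
    identities between conditional expectations follow from the tower property:
    over a set of sX n the maps Y_n, Y, X and X_n all have the same integral,
    because sX n is contained in both sXY n and the sigma-algebra of X, and
    restricting to a smaller sigma-algebra for which X_n or Y_n is still
    measurable preserves the relation. Everything rests on one estimate for
    Bochner integrals, [bochner_dist]: two integrals over A differ by at most
    the integral over A of the pointwise distance.

    The convergences are Levy's upward theorem for Banach-valued maps. Let Z n
    be the conditional expectation of f given the n-th sigma-algebra of the
    filtration, where f is measurable for the limit sigma-algebra.
    - By [Lp_dense], f is close in mean of order p to a simple map S measurable
      at some stage m. First f is replaced by its nearest point among finitely
      many points of a dense sequence (separability and dominated convergence);
      then each level set is replaced by a set of a finite stage, since the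
      sets that can be so approximated in measure form a sigma-algebra
      ([limit_sigma_algebra_approximable]).
    - By [cond_exp_contraction], for n >= m the integral of |Z n - S|^p over
      any set of stage n is at most that of |f - S|^p: on a fibre Z n - S is
      constant and is the average of f - S, and Jensen's inequality applies.
    - Over the whole space this gives convergence in mean. Over the sets where
      |Z n - S| exceeds a level for the first time it gives the maximal
      inequality ([maximal_inequality]), hence almost sure convergence, as the
      event where Z n does not stay close to f has arbitrarily small
      probability. *)

Set Implicit Arguments.
Unset Strict Implicit.
Unset Printing Implicit Defensive.

Local Open Scope classical_set_scope.
Local Open Scope ring_scope.

(** * Sigma-algebras of unions of fibres *)

(** Sets that are unions of fibres of a. For a map with finitely many values
    this is the sigma-algebra it generates, in a form where measurability is
    invariance and no generating process has to be unwound. *)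
Definition saturated (T K : Type) (a : T -> K) : set (set T) :=
  [set A | forall w w', a w = a w' -> A w -> A w'].

Lemma saturated_comp (T T' K : Type) (a : T' -> K) (X : T -> T') (A : set T') :
  saturated a A -> saturated (a \o X) (X @^-1` A).
Proof. by move=> sA w w'; apply: sA. Qed.

Lemma sigma_algebra_saturated (T K : Type) (a : T -> K) :
  sigma_algebra setT (saturated a).
Proof.
split=> [//|A sA w w' e [_ nA]|A sA w w' e [n _ An]].
- by split=> // /(sA _ _ (esym e)).
- by exists n => //; apply: sA An.
Qed.

Lemma sigma_algebraU (T : Type) (G : set (set T)) (A B : set T) :
  sigma_algebra setT G -> G A -> G B -> G (A `|` B).
Proof.
by move=> [G0 _ GU] GA GB; rewrite -bigcup2E; apply: GU => -[|[|n]].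
Qed.

Lemma sigma_algebraC (T : Type) (G : set (set T)) (A : set T) :
  sigma_algebra setT G -> G A -> G (~` A).
Proof. by move=> [_ GC _] /GC; rewrite setTD. Qed.

Lemma sigma_algebraI (T : Type) (G : set (set T)) (A B : set T) :
  sigma_algebra setT G -> G A -> G B -> G (A `&` B).
Proof.
move=> sG GA GB; rewrite -[A `&` B]setCK setCI.
apply: sigma_algebraC => //; apply: sigma_algebraU => //;
  exact: sigma_algebraC.
Qed.

Lemma sigma_algebra_fin_bigcup (T : Type) (I : choiceType) (D : set I)
    (F : I -> set T) (G : set (set T)) :
  sigma_algebra setT G -> finite_set D -> (forall i, D i -> G (F i)) ->
  G (\bigcup_(i in D) F i).
Proof.
move=> sG finD GF; rewrite -bigsetU_fset_set// big_seq; apply: big_ind.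
- by case: sG.
- by move=> A B; apply: sigma_algebraU.
- by move=> i; rewrite in_fset_set// inE => /GF.
Qed.

(** A saturated set is a finite union of fibres. *)
Lemma saturated_sub (T : Type) (K : choiceType) (a : T -> K)
    (G : set (set T)) :
  sigma_algebra setT G -> finite_set (range a) ->
  (forall w, G (a @^-1` [set a w])) -> saturated a `<=` G.
Proof.
move=> sG fa Ga A sA.
have -> : A = \bigcup_(k in a @` A) a @^-1` [set k].
  apply/seteqP; split=> [w Aw|w [_ [w' Aw' <-] e]].
    by exists (a w); [exists w|].
  by apply: sA Aw'; rewrite e.
apply: sigma_algebra_fin_bigcup => //.
  by apply: sub_finite_set fa => _ [w _ <-]; exists w.
by move=> _ [w _ <-].
Qed.

(** For a partition the union has a single term, the part that contains x;
    taking a union makes the map total. *)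
Definition block (U : Type) (Pi : set (set U)) (x : U) : set U :=
  \bigcup_(Q in [set Q | Pi Q /\ Q x]) Q.

Lemma block_eq (U : Type) (Pi : set (set U)) (Q : set U) x :
  partition Pi id setT -> Pi Q -> Q x -> block Pi x = Q.
Proof.
move=> [_ tPi _] PQ Qx; apply/seteqP; split=> [y [Q' [PQ' Q'x] Q'y]|y Qy].
  by rewrite (tPi Q Q') //; exists x.
by exists Q.
Qed.

Lemma block_in (U : Type) (Pi : set (set U)) x :
  partition Pi id setT -> Pi (block Pi x) /\ block Pi x x.
Proof.
move=> pPi; have [cPi _ _] := pPi.
have [Q PQ Qx] : cover Pi id x by rewrite cPi.
by rewrite (block_eq pPi PQ Qx).
Qed.

Lemma saturated_block (U : Type) (Pi : set (set U)) (Q : set U) :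
  partition Pi id setT -> Pi Q -> saturated (block Pi) Q.
Proof.
move=> pPi PQ x y e Qx; move: e; rewrite (block_eq pPi PQ Qx) => ->.
by have [] := block_in y pPi.
Qed.

Lemma fibre_block (T U : Type) (Pi : set (set U)) (X : T -> U) (w : T) :
  partition Pi id setT ->
  (block Pi \o X) @^-1` [set block Pi (X w)] = X @^-1` (block Pi (X w)).
Proof.
move=> pPi; have [PQ Qx] := block_in (X w) pPi.
apply/seteqP; split=> w' /= => [<-|Qw']; first by have [] := block_in (X w') pPi.
exact: block_eq.
Qed.

Lemma finite_range_block (T U : Type) (Pi : set (set U)) (X : T -> U) :
  partition Pi id setT -> finite_set Pi -> finite_set (range (block Pi \o X)).
Proof.
move=> pPi; apply: sub_finite_set => _ [w _ <-].
by have [] := block_in (X w) pPi.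
Qed.

(** The sigma-algebra pulled back from a finite partition is the algebra of
    unions of fibres of the map sending w to the block of X w; this is what
    makes every conditional expectation below an average over blocks. *)
Lemma sigma_partition (T U : Type) (Pi : set (set U)) (X : T -> U) :
  partition Pi id setT -> finite_set Pi ->
  <<s preimage_set_system setT X Pi >> = saturated (block Pi \o X).
Proof.
move=> pPi fPi; apply/seteqP; split.
  apply: smallest_sub; first exact: sigma_algebra_saturated.
  move=> _ [Q PQ <-]; rewrite setTI.
  by apply: saturated_comp; apply: saturated_block.
apply: saturated_sub; first exact: smallest_sigma_algebra.
  exact: finite_range_block.
move=> w; rewrite /= fibre_block//; apply: sub_gen_smallest.
by exists (block Pi (X w)); rewrite ?setTI//; have [] := block_in (X w) pPi.
Qed.

Lemma sigma_partition_id (U : Type) (Pi : set (set U)) :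
  partition Pi id setT -> finite_set Pi -> <<s Pi >> = saturated (block Pi).
Proof.
move=> pPi fPi; rewrite -[RHS](sigma_partition id pPi fPi).
congr (<<s _ >>); apply/seteqP; split=> [Q PQ|_ [Q PQ <-]].
  by exists Q; rewrite ?setTI.
by rewrite setTI.
Qed.

(** An inclusion of the generated sigma-algebras says that each part of Pi is
    a union of parts of Pi', so points in one part of Pi' share a part of Pi. *)
Lemma block_refine (U : Type) (Pi Pi' : set (set U)) x y :
  partition Pi id setT -> finite_set Pi ->
  partition Pi' id setT -> finite_set Pi' ->
  <<s Pi >> `<=` <<s Pi' >> -> block Pi' x = block Pi' y ->
  block Pi x = block Pi y.
Proof.
move=> pPi fPi pPi' fPi'; rewrite (sigma_partition_id pPi') // => sub e.
have [PQ Qx] := block_in x pPi.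
by apply/esym/block_eq => //; apply: (sub _ _ x y e Qx); apply: sub_gen_smallest.
Qed.

Lemma sigma_join_saturated (T : Type) (K L : choiceType) (a : T -> K)
    (b : T -> L) :
  finite_set (range a) -> finite_set (range b) ->
  sigma_join (saturated a) (saturated b) = saturated (fun w => (a w, b w)).
Proof.
move=> fa fb; apply/seteqP; split.
  apply: smallest_sub; first exact: sigma_algebra_saturated.
  by move=> A [] sA w w' [ea eb]; apply: sA.
have sJ := @smallest_sigma_algebra _ setT (saturated a `|` saturated b).
apply: saturated_sub => //.
  apply: sub_finite_set (finite_setX fa fb).
  by move=> _ [w _ <-]; split; exists w.
move=> w; have -> : (fun w0 => (a w0, b w0)) @^-1` [set (a w, b w)] =
    a @^-1` [set a w] `&` b @^-1` [set b w].
  by apply/seteqP; split=> w' /= => [[-> ->]|[-> ->]].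
apply: (sigma_algebraI sJ); apply: sub_gen_smallest; [left|right].
- by move=> u v /= <-.
- by move=> u v /= <-.
Qed.

(** * Borel measurability in a separable normed space *)

Section measurability.
Context {d : measure_display} {T : measurableType d} {R : realType}
  {B : completeNormedModType R}.
Implicit Types (f g : T -> B) (A : set T).

Lemma borel_open (U : set B) : open U -> borel U.
Proof. exact: sub_gen_smallest. Qed.

Lemma borel_set1 (b : B) : borel [set b].
Proof.
have sB : sigma_algebra setT (@borel B) by exact: smallest_sigma_algebra.
rewrite -[[set b]]setCK; apply: (sigma_algebraC sB).
apply: borel_open; rewrite openC; apply: accessible_closed_set1.
exact/hausdorff_accessible/norm_hausdorff.
Qed.

Lemma borel_rv_preimage f (U : set B) :
  borel_rv f -> borel U -> measurable (f @^-1` U).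
Proof. by move=> bf bU; apply: bf; exists U; rewrite ?setTI. Qed.

Lemma borel_rv_cst (b : B) : borel_rv (cst b : T -> B).
Proof. by move=> _ [U _ <-]; rewrite setTI preimage_cst; case: ifP. Qed.

Lemma measurable_real_lt (h : T -> R) :
  (forall x, measurable (h @^-1` [set y | y < x])) -> measurable_fun setT h.
Proof.
move=> hlt; apply: (measurability _ (RGenInftyO.measurableE R)).
move=> _ [_ [x ->] <-]; rewrite setTI.
by rewrite (_ : _ @^-1` _ = h @^-1` [set y | y < x])//; apply/seteqP; split=> w;
  rewrite /= in_itv.
Qed.

Lemma measurable_ltr_set (u v : T -> R) : measurable_fun setT u ->
  measurable_fun setT v -> measurable [set w | u w < v w].
Proof.
move=> mu mv.
have := measurable_fun_ltr mu mv measurableT (I : measurable [set true]).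
by rewrite setTI; congr measurable; apply/seteqP; split=> w /= ->.
Qed.

Lemma measurable_norm_cst f (b : B) :
  borel_rv f -> measurable_fun setT (fun w => `|f w - b|).
Proof.
move=> bf; apply: measurable_real_lt => x.
rewrite (_ : _ @^-1` _ = f @^-1` ball b x); last first.
  by apply/seteqP; split=> w; rewrite /= -ball_normE /= distrC.
by apply: borel_rv_preimage => //; apply: borel_open; exact: ball_open.
Qed.

Lemma separable_sequence : separable_space B ->
  exists x : nat -> B, forall b (e : R), 0 < e -> exists n, `|b - x n| < e.
Proof.
move=> [D cD dD]; have near_D (b : B) (e : R) : 0 < e -> exists2 y, D y & `|b - y| < e.
  move=> e0; have [||y [yb Dy]] := dD (ball b e).
  - by exists b; exact: ballxx.
  - exact: ball_open.
  - by exists y => //; move: yb; rewrite -ball_normE.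
have /pfcard_geP[D0|[x]] := cD.
  by have [y] := near_D 0 1 ltr01; rewrite D0.
exists x => b e /(near_D b)[y Dy yb].
by have [n _ xn] := @surj _ _ _ _ x y Dy; exists n; rewrite xn.
Qed.

(** The triangle inequality through a dense point writes a strict upper bound
    on the distance as a countable union of sums of one-variable conditions. *)
Lemma measurable_normB f g : separable_space B ->
  borel_rv f -> borel_rv g -> measurable_fun setT (fun w => `|f w - g w|).
Proof.
move=> /separable_sequence[x dx] bf bg; apply: measurable_real_lt => r.
have -> : (fun w => `|f w - g w|) @^-1` [set y | y < r] =
    \bigcup_n [set w | `|f w - x n| + `|g w - x n| < r].
  apply/seteqP; split=> [w /= fgr|w [n _ /=]]; last first.
    by apply: le_lt_trans; rewrite -(distrC (x n) (g w)) ler_distD.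
  have e0 : 0 < (r - `|f w - g w|) / 2 by rewrite divr_gt0// subr_gt0.
  have [n gx] := dx (g w) _ e0; exists n => //=.
  have : `|f w - x n| <= `|f w - g w| + `|g w - x n| by apply: ler_distD.
  lra.
apply: bigcupT_measurable => n.
apply: measurable_ltr_set => //.
by apply: measurable_funD; apply: measurable_norm_cst.
Qed.

End measurability.

(** * Integration along a finite-valued map *)

Section labels.
Context {d : measure_display} {T : measurableType d} {R : realType}.
Context (P : probability T R).

(** Measurability is a condition on saturated sets because the set K of labels
    carries no sigma-algebra. *)
Definition finite_label (K : Type) (a : T -> K) : Prop :=
  finite_set (range a) /\ saturated a `<=` measurable.

Lemma saturated_fibre (K : Type) (a : T -> K) k : saturated a (a @^-1` [set k]).
Proof. by move=> w w' /= ->. Qed.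

Lemma measurable_fibre (K : Type) (a : T -> K) k :
  finite_label a -> measurable (a @^-1` [set k]).
Proof. by move=> [_ ma]; apply: ma; exact: saturated_fibre. Qed.

Lemma finite_label_pair (K L : choiceType) (a : T -> K) (b : T -> L) :
  finite_label a -> finite_label b -> finite_label (fun w => (a w, b w)).
Proof.
move=> [fa ma] [fb mb]; split.
  by apply: sub_finite_set (finite_setX fa fb) => _ [w _ <-]; split; exists w.
rewrite -sigma_join_saturated//; apply: smallest_sub.
  exact: sigma_algebra_measurable.
by move=> A [/ma|/mb].
Qed.

Lemma integral_fibres (K : choiceType) (a : T -> K) (A : set T)
    (phi : T -> \bar R) :
  finite_label a -> measurable A -> measurable_fun setT phi ->
  (forall w, 0 <= phi w)%E ->
  (\int[P]_(w in A) phi w =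
   \sum_(k <- fset_set (range a)) \int[P]_(w in A `&` a @^-1` [set k]) phi w)%E.
Proof.
move=> la mA mphi phi0; have [fa _] := la.
rewrite -ge0_integral_bigsetU//.
- congr integral; rewrite bigsetU_fset_set//.
  by apply/seteqP; split=> [w Aw|w [_ _ []]//]; exists (a w); [exists w|].
- by move=> k; apply: measurableI => //; exact: measurable_fibre.
- by move=> i j _ _ [w [[_ <-] [_ <-]]].
- exact: measurable_funTS.
Qed.

Lemma integral_fibre_cst (K : choiceType) (a : T -> K) (A : set T) (r : R) k
    (phi : T -> \bar R) :
  finite_label a -> measurable A -> (forall w, a w = k -> phi w = r%:E) ->
  (\int[P]_(w in A `&` a @^-1` [set k]) phi w =
   (r * fine (P (A `&` a @^-1` [set k])))%:E)%E.
Proof.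
move=> la mA phir.
have mAk : measurable (A `&` a @^-1` [set k]).
  by apply: measurableI => //; exact: measurable_fibre.
rewrite EFinM fineK ?fin_num_measure// -integral_cst//.
by apply: eq_integral => w; rewrite inE => -[_ /phir].
Qed.

Lemma integral_label (K : choiceType) (a : T -> K) (A : set T)
    (h : K -> R) :
  finite_label a -> measurable A -> (forall k, 0 <= h k) ->
  (\int[P]_(w in A) (h (a w))%:E =
   (\sum_(k <- fset_set (range a)) h k * fine (P (A `&` a @^-1` [set k])))%:E)%E.
Proof.
move=> la mA h0; rewrite (integral_fibres la mA) => [| |w]; last first.
- by rewrite lee_fin.
- move=> _ U mU; rewrite setTI; have [_ ma] := la; apply: ma.
  by move=> w w' /= ->.
rewrite -sumEFin; apply: eq_bigr => k _; apply: integral_fibre_cst => // w.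
by move=> ->.
Qed.

Lemma measure_fibres (K : choiceType) (a : T -> K) (A : set T) :
  finite_label a -> measurable A ->
  fine (P A) = \sum_(k <- fset_set (range a)) fine (P (A `&` a @^-1` [set k])).
Proof.
move=> la mA; apply: EFin_inj; rewrite fineK ?fin_num_measure//.
rewrite -[P A]mul1e -integral_cst// (integral_label (h := cst 1) la mA)//.
by congr EFin; apply: eq_bigr => k _; rewrite mul1r.
Qed.

End labels.

(** * The Bochner integral *)

Section bochner_integral.
Context {d : measure_display} {T : measurableType d} {R : realType}.
Context (P : probability T R) {B : completeNormedModType R}.
Implicit Types (f g s : T -> B) (A : set T).

(** The defining sum of the simple integral, reindexed by any finite label
    through which the map factors. Two simple maps can then be compared term by
    term, over the label formed by the pair of their values. *)
Lemma simple_integral_label (K : choiceType) (a : T -> K) A (g : K -> B) :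
  finite_label a -> measurable A ->
  simple_integral P A (g \o a) =
  \sum_(k <- fset_set (range a)) fine (P (A `&` a @^-1` [set k])) *: g k.
Proof.
move=> la mA; have [fa ma] := la.
have fg : finite_set (range (g \o a)).
  by rewrite -(image_comp a g); apply: finite_image.
rewrite /simple_integral fsbig_finite//=.
have cE b : fine (P (A `&` (g \o a) @^-1` [set b])) =
    \sum_(k <- fset_set (range a))
      if g k == b then fine (P (A `&` a @^-1` [set k])) else 0.
  have mAb : measurable (A `&` (g \o a) @^-1` [set b]).
    by apply: measurableI => //; apply: ma => w w' /= ->.
  rewrite (measure_fibres P la mAb); apply: eq_bigr => k _.
  case: eqP => gk.
    rewrite (_ : A `&` _ `&` _ = A `&` a @^-1` [set k])//.
    apply/seteqP; split=> w /= [] => [[Aw _] aw//|Aw aw].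
    by split=> //; split=> //; rewrite aw.
  rewrite (_ : _ `&` _ = set0) ?measure0//.
  by apply/seteqP; split=> w // [[_ gb] aw]; apply: gk; rewrite -aw.
under eq_bigr do rewrite cE scaler_suml.
rewrite exchange_big /=; apply: eq_big_seq => k.
rewrite in_fset_set// inE => -[w _ <-].
rewrite (big_fsetD1 (g (a w))) /=; last first.
  by rewrite in_fset_set// inE; exists w.
rewrite eqxx big_seq big1 ?addr0// => b.
by rewrite in_fsetD1 eq_sym => /andP[/negPf -> _]; rewrite scale0r.
Qed.

Lemma simple_finite_label s : simple_rv s -> finite_label s.
Proof.
move=> [bs fs]; split=> //; apply: saturated_sub => //.
  exact: sigma_algebra_measurable.
by move=> w; apply: borel_rv_preimage => //; exact: borel_set1.
Qed.

Lemma finite_label_simple (K : Type) (a : T -> K) (g : K -> B) :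
  finite_label a -> simple_rv (g \o a).
Proof.
move=> [fa ma]; split; last by rewrite -(image_comp a g); exact: finite_image.
by move=> _ [U _ <-]; rewrite setTI; apply: ma => w w' /= ->.
Qed.

Lemma measurable_simple_pair (g g' : T -> B) (Q : B -> B -> Prop) :
  simple_rv g -> simple_rv g' -> measurable [set w | Q (g w) (g' w)].
Proof.
move=> /simple_finite_label lg /simple_finite_label lg'.
have [_ sub] := finite_label_pair lg lg'.
by apply: sub => w w' [eg eg'] /=; rewrite eg eg'.
Qed.

Lemma simple_integral_dist A s s' : measurable A -> simple_rv s -> simple_rv s' ->
  (`|simple_integral P A s - simple_integral P A s'|%:E <=
   \int[P]_(w in A) (`|s w - s' w|)%:E)%E.
Proof.
move=> mA /simple_finite_label ls /simple_finite_label ls'.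
have la := finite_label_pair ls ls'.
rewrite (simple_integral_label fst la mA) (simple_integral_label snd la mA).
rewrite (integral_label (h := fun k => `|k.1 - k.2|) P la mA)// lee_fin.
rewrite -sumrB; apply: le_trans (ler_norm_sum _ _ _) _.
apply: ler_sum => k _; rewrite -scalerBr normrZ mulrC ger0_norm//.
exact: fine_ge0.
Qed.

Hypothesis sepB : separable_space B.

Lemma measurable_EnormB f g : borel_rv f -> borel_rv g ->
  measurable_fun setT (fun w => (`|f w - g w|)%:E).
Proof. by move=> bf bg; apply/measurable_EFinP; apply: measurable_normB. Qed.

Lemma integral_triangle A f g h : measurable A ->
  borel_rv f -> borel_rv g -> borel_rv h ->
  (\int[P]_(w in A) (`|f w - h w|)%:E <=
   \int[P]_(w in A) (`|f w - g w|)%:E + \int[P]_(w in A) (`|g w - h w|)%:E)%E.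
Proof.
move=> mA bf bg bh.
have m := fun u v bu bv => measurable_funTS (D := A) (@measurable_EnormB u v bu bv).
rewrite -ge0_integralD//; [|exact: m..].
apply: ge0_le_integral => //; [exact: m| |].
  by apply: emeasurable_funD; exact: m.
by move=> w _; rewrite -EFinD lee_fin ler_distD.
Qed.

(** Pass to the limit in the estimate for simple maps. This single inequality
    gives both uniqueness of the Bochner integral and the contraction property
    of conditional expectation. *)
Lemma bochner_dist A f g u v : measurable A ->
  has_bochner_integral P A f u -> has_bochner_integral P A g v ->
  (`|u - v|%:E <= \int[P]_(w in A) (`|f w - g w|)%:E)%E.
Proof.
move=> mA [bf [s [ss sf su]]] [bg [t [st tg tv]]].
have bound n : (`|simple_integral P A (s n) - simple_integral P A (t n)|%:E <=
    \int[P]_(w in A) (`|f w - s n w|)%:E + \int[P]_(w in A) (`|f w - g w|)%:E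
    + \int[P]_(w in A) (`|g w - t n w|)%:E)%E.
  have [bs _] := ss n; have [bt _] := st n.
  apply: le_trans (simple_integral_dist mA (ss n) (st n)) _.
  apply: le_trans (integral_triangle mA bs bg bt) _.
  rewrite leeD2r//; apply: le_trans (integral_triangle mA bs bf bg) _.
  rewrite leeD2r//; apply: ge0_le_integral => //.
  - by apply: measurable_funTS; exact: measurable_EnormB.
  - by apply: measurable_funTS; exact: measurable_EnormB.
  - by move=> w _; rewrite distrC.
set I := (\int[P]_(w in A) (`|f w - g w|)%:E)%E in bound *.
have I0 : (0 <= I)%E by apply: integral_ge0 => w _; rewrite lee_fin.
have lhs : (`|simple_integral P A (s n) - simple_integral P A (t n)|%:E)
    @[n --> \oo] --> (`|u - v|%:E : \bar R).
  apply: cvg_EFin; first by apply: nearW.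
  by apply: cvg_norm; apply: cvgB.
have rhs : (\int[P]_(w in A) (`|f w - s n w|)%:E + I +
    \int[P]_(w in A) (`|g w - t n w|)%:E)%E @[n --> \oo] --> (0 + I + 0)%E.
  apply: cvgeD (tg); first by rewrite add0e; apply: ge0_adde_def; rewrite !inE.
  apply: cvgeD (sf) _; first by apply: ge0_adde_def; rewrite !inE.
  exact: cvg_cst.
by rewrite -[I]add0e -[(0 + I)%E]adde0; apply: lee_cvg_to lhs rhs (nearW _ bound).
Qed.

Lemma bochner_unique A f u v : measurable A ->
  has_bochner_integral P A f u -> has_bochner_integral P A f v -> u = v.
Proof.
move=> mA fu fv; apply/eqP; rewrite -subr_eq0 -normr_le0 -lee_fin.
apply: le_trans (bochner_dist mA fu fv) _.
by under eq_integral do rewrite subrr normr0; rewrite integral0.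
Qed.

End bochner_integral.

(** * Approximation in mean by nearest points *)

Section nearest_approximation.
Context {R : realType} {B : completeNormedModType R}.
Variable x : nat -> B.

(** A nearest point among 0, x 0, ..., x (n - 1). Including 0 keeps the
    distance to b below the norm of b, which is the dominating function for
    the convergence in mean. *)
Fixpoint nearest (n : nat) (b : B) : B :=
  if n is m.+1 then
    if `|b - x m| < `|b - nearest m b| then x m else nearest m b
  else 0.

Lemma nearest_noninc n m b : (n <= m)%N -> `|b - nearest m b| <= `|b - nearest n b|.
Proof.
elim: m => [|m IH]; first by rewrite leqn0 => /eqP ->.
rewrite leq_eqVlt => /predU1P[->//|]; rewrite ltnS => /IH le_nm /=.
by case: ifP => // /ltW /le_trans; apply.
Qed.

Lemma nearest_norm n b : `|b - nearest n b| <= `|b|.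
Proof. by apply: le_trans (nearest_noninc b (leq0n n)) _; rewrite subr0. Qed.

Lemma nearest_le n b : `|b - nearest n.+1 b| <= `|b - x n|.
Proof. by rewrite /=; case: ltP. Qed.

Lemma nearest_cvg b : (forall e, 0 < e -> exists n, `|b - x n| < e) ->
  `|b - nearest n b| @[n --> \oo] --> (0 : R).
Proof.
move=> dx; apply/cvgrPdist_lt => e /dx[N xN]; exists N.+1 => // n /= Nn.
rewrite sub0r normrN normr_id.
by apply: le_lt_trans (nearest_noninc b Nn) (le_lt_trans (nearest_le N b) xN).
Qed.

Lemma nearest_finite n : finite_set (range (nearest n)).
Proof.
elim: n => [|n IH]; first by apply: sub_finite_set (finite_set1 0) => _ [w _ <-].
apply: (@sub_finite_set _ _ (x n |` range (nearest n))).
  by move=> _ [w _ <-] /=; case: ifP => _; [left|right; exists w].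
by rewrite finite_setU; split; [exact: finite_set1|].
Qed.

(** The composite of a Borel map with this one is again Borel, so the
    statement is proved once on B itself with its Borel sets. *)
Lemma nearest_borel (sepB : separable_space B) n :
  @borel_rv _ (g_sigma_algebraType (@open B)) R B (nearest n).
Proof.
have bid : @borel_rv _ (g_sigma_algebraType (@open B)) R B id.
  by move=> _ [U bU <-]; rewrite setTI.
elim: n => [|n IH]; first exact: borel_rv_cst.
move=> _ [U bU <-]; rewrite setTI.
have mlt : measurable ([set b | `|b - x n| < `|b - nearest n b|] :
    set (g_sigma_algebraType (@open B))).
  apply: (measurable_ltr_set (T := g_sigma_algebraType (@open B))).
    exact: (@measurable_norm_cst _ (g_sigma_algebraType (@open B)) R B id).
  exact: (@measurable_normB _ (g_sigma_algebraType (@open B)) R B id).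
have -> : nearest n.+1 @^-1` U =
    ([set b | `|b - x n| < `|b - nearest n b|] `&` cst (x n) @^-1` U) `|`
    (~` [set b | `|b - x n| < `|b - nearest n b|] `&` nearest n @^-1` U).
  apply/seteqP; split=> b; rewrite /= /nearest -/nearest.
    by case: ifP => [lt Ux|lt Ux]; [left|right].
  by case: ifP => [lt [[_]//|[/(_ isT)]]|lt [[]//|[]//]].
apply: measurableU; apply: measurableI => //; [| |].
- by rewrite preimage_cst; case: ifP.
- exact: measurableC.
- by apply: IH; exists U; rewrite ?setTI.
Qed.

Lemma nearest_preimage (sepB : separable_space B) n (U : set B) :
  borel U -> borel (nearest n @^-1` U).
Proof.
by move=> bU; apply: (nearest_borel sepB (n := n)); exists U; rewrite ?setTI.
Qed.

End nearest_approximation.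

Section Lp_distance.
Context {d : measure_display} {T : measurableType d} {R : realType}.
Context (P : probability T R) {B : completeNormedModType R}.
Hypothesis sepB : separable_space B.
Implicit Types (f g h : T -> B) (p : R).

(** The p-th power of the distance in mean of order p. Without the p-th root
    there is only a quasi-triangle inequality with constant 2 ^ p, which is
    enough to prove convergence to zero. *)
Definition Lp_dist p f g : \bar R := (\int[P]_w (`|f w - g w| `^ p)%:E)%E.

Lemma powRD_le (a b p : R) : 0 <= a -> 0 <= b -> 0 <= p ->
  (a + b) `^ p <= 2 `^ p * (a `^ p + b `^ p).
Proof.
move=> a0 b0 p0; have [ab|ba] := leP a b.
  apply: (@le_trans _ _ ((2 * b) `^ p)).
    by apply: ge0_ler_powR; rewrite ?nnegrE; lra.
  rewrite powRM// ler_wpM2l ?powR_ge0// lerDr powR_ge0//.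
apply: (@le_trans _ _ ((2 * a) `^ p)).
  by apply: ge0_ler_powR; rewrite ?nnegrE; lra.
by rewrite powRM// ler_wpM2l ?powR_ge0// lerDl powR_ge0.
Qed.

Lemma measurable_normB_powR p f g : borel_rv f -> borel_rv g ->
  measurable_fun setT (fun w => (`|f w - g w| `^ p)%:E).
Proof.
move=> bf bg; apply/measurable_EFinP.
by apply: (measurableT_comp (measurable_powR p)); apply: measurable_normB.
Qed.

Lemma Lp_dist_ge0 p f g : (0 <= Lp_dist p f g)%E.
Proof. by apply: integral_ge0 => w _; rewrite lee_fin powR_ge0. Qed.

Lemma Lp_distC p f g : Lp_dist p f g = Lp_dist p g f.
Proof. by apply: eq_integral => w _; rewrite distrC. Qed.

Lemma Lp_dist_triangle p f g h : 0 <= p ->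
  borel_rv f -> borel_rv g -> borel_rv h ->
  (Lp_dist p f h <= (2 `^ p)%:E * (Lp_dist p f g + Lp_dist p g h))%E.
Proof.
move=> p0 bf bg bh.
rewrite -ge0_integralD//; [|exact: measurable_normB_powR..].
rewrite -ge0_integralZl_EFin ?powR_ge0//; last 2 first.
- by move=> w _; apply: adde_ge0; rewrite lee_fin powR_ge0.
- by apply: emeasurable_funD; exact: measurable_normB_powR.
apply: ge0_le_integral => //.
- exact: measurable_normB_powR.
- apply: measurable_funeM.
  by apply: emeasurable_funD; exact: measurable_normB_powR.
- move=> w _; rewrite -EFinD -EFinM lee_fin.
  apply: le_trans (powRD_le _ _ p0) => //.
  by apply: ge0_ler_powR; rewrite ?nnegrE ?addr_ge0// ler_distD.
Qed.

Lemma nearest_simple_rv (x : nat -> B) n f : borel_rv f -> simple_rv (nearest x n \o f).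
Proof.
move=> bf; split; last first.
  apply: sub_finite_set (nearest_finite x n) => _ [w _ <-].
  by exists (f w).
move=> _ [U bU <-]; rewrite setTI comp_preimage; apply: borel_rv_preimage => //.
exact: nearest_preimage.
Qed.

Lemma nearest_sigma_rv (x : nat -> B) n f : sigma_rv (nearest x n \o f) `<=` sigma_rv f.
Proof.
move=> _ [U bU <-]; rewrite setTI comp_preimage; exists (nearest x n @^-1` U).
  exact: nearest_preimage.
by rewrite setTI.
Qed.

(** Dominated convergence: the distances tend to 0 pointwise and stay below
    the norm of f. *)
Lemma Lp_nearest_cvg (x : nat -> B) p f : 1 <= p ->
  (forall b (e : R), 0 < e -> exists n, `|b - x n| < e) ->
  borel_rv f -> (Lp_dist p f (cst 0%R) < +oo)%E ->
  Lp_dist p f (nearest x n \o f) @[n --> \oo] --> 0%E.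
Proof.
move=> p1 dx bf fp; have p0 : 0 <= p by lra.
have bs n := nearest_simple_rv x n bf.
have b0 := @borel_rv_cst _ T R B 0.
pose phi n w := (`|f w - nearest x n (f w)| `^ p)%:E.
have mphi n : measurable_fun setT (phi n).
  by apply: measurable_normB_powR => //; have [] := bs n.
have cphi : {ae P, forall w, setT w -> phi n w @[n --> \oo] --> 0%E}.
  apply: aeW => w _; apply: cvg_EFin; first by apply: nearW.
  apply/cvgrPdist_lt => e e0.
  have m0 : 0 < Num.min e 1 by rewrite lt_min e0 ltr01.
  have /cvgrPdist_lt/(_ _ m0) := nearest_cvg (dx (f w)).
  apply: filterS => n /=; rewrite !sub0r !normrN normr_id lt_min => /andP[be b1].
  rewrite ger0_norm ?powR_ge0//; apply: le_lt_trans be.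
  (* a number in [0, 1] only decreases when raised to a power p >= 1 *)
  have [->|n0] := eqVneq (`|f w - nearest x n (f w)|) 0.
    by rewrite powR0//; lra.
  have := @ge1r_powRZ R `|f w - nearest x n (f w)| 1 p.
  rewrite powR1 !mulr1; apply => //.
  by rewrite lt_neqAle eq_sym n0 normr_ge0 ltW.
have dphi : {ae P, forall w n, setT w -> (`|phi n w| <= (`|f w - 0| `^ p)%:E)%E}.
  apply: aeW => w n _; rewrite gee0_abs ?lee_fin ?powR_ge0// subr0.
  by apply: ge0_ler_powR; rewrite ?nnegrE// nearest_norm.
have iphi : P.-integrable setT (fun w => (`|f w - 0| `^ p)%:E).
  apply/integrableP; split; first exact: measurable_normB_powR.
  under eq_integral do rewrite gee0_abs ?lee_fin ?powR_ge0//.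
  exact: fp.
have [_ _] := dominated_convergence measurableT mphi (measurable_cst 0%E)
  cphi iphi dphi.
by rewrite integral0.
Qed.

End Lp_distance.

(** * Existence of Bochner integrals and conditional expectations *)

Lemma cvge0_nnegP (R : realType) (u : nat -> \bar R) : (forall n, 0 <= u n)%E ->
  (u n @[n --> \oo] --> 0%E) <->
  (forall e : R, 0 < e -> \forall n \near \oo, (u n < e%:E)%E).
Proof.
move=> u0; split.
  move=> /fine_cvgP[finu /cvgrPdist_lt cu] e /cu.
  move: finu; apply: filterS2 => n finu /=.
  by rewrite sub0r normrN ger0_norm ?fine_ge0// -lte_fin fineK.
move=> small; apply/fine_cvgP; split.
  apply: filterS (small 1 ltr01) => n u1.
  by rewrite ge0_fin_numE//; apply: lt_trans u1 (ltry _).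
apply/cvgrPdist_lt => e /small; apply: filterS => n un.
have finu : u n \is a fin_num by rewrite ge0_fin_numE//; apply: lt_trans un (ltry _).
by rewrite sub0r normrN ger0_norm ?fine_ge0// -lte_fin fineK.
Qed.

Section bochner_existence.
Context {d : measure_display} {T : measurableType d} {R : realType}.
Context (P : probability T R) {B : completeNormedModType R}.
Hypothesis sepB : separable_space B.
Implicit Types (f g s : T -> B) (A : set T).

Lemma Lp_dist1 f g : Lp_dist P 1 f g = (\int[P]_w (`|f w - g w|)%:E)%E.
Proof. by apply: eq_integral => w _; rewrite powRr1. Qed.

Lemma integral_sub_le A f g : measurable A -> borel_rv f -> borel_rv g ->
  (\int[P]_(w in A) (`|f w - g w|)%:E <= \int[P]_w (`|f w - g w|)%:E)%E.
Proof.
by move=> mA bf bg; apply: ge0_subset_integral => //; exact: measurable_EnormB.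
Qed.

(** The integrals form a Cauchy sequence in the complete space B. One
    approximating sequence serves every set A, so that the limit is additive in
    A. *)
Lemma simple_integral_cvg (s : nat -> T -> B) f A :
  (forall n, simple_rv (s n)) -> borel_rv f -> measurable A ->
  (\int[P]_w (`|f w - s n w|)%:E)%E @[n --> \oo] --> 0%E ->
  cvgn (fun n => simple_integral P A (s n)).
Proof.
move=> ss bf mA /cvge0_nnegP; move=> /(_ (fun n => integral_ge0 _ _)) small.
apply: cauchy_cvg; apply: cauchy_exP => e e0.
have e2 : 0 < e / 2 by rewrite divr_gt0.
have [|N _ smallN] := small _ _ e2; first by move=> n w _; rewrite lee_fin.
exists (simple_integral P A (s N)); exists N => // n /= Nn.
rewrite -ball_normE /= -lte_fin.
apply: le_lt_trans (simple_integral_dist P mA (ss N) (ss n)) _.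
have [bN _] := ss N; have [bn _] := ss n.
apply: le_lt_trans (integral_triangle P sepB mA bN bf bn) _.
rewrite [e]splitr EFinD; apply: lteD.
  apply: le_lt_trans (integral_sub_le mA bN bf) _.
  by under eq_integral do rewrite distrC; apply: smallN => /=.
by apply: le_lt_trans (integral_sub_le mA bf bn) _; apply: smallN.
Qed.

Lemma has_bochner_simple A s : simple_rv s ->
  has_bochner_integral P A s (simple_integral P A s).
Proof.
move=> ss; split; first by case: ss.
exists (fun=> s); split=> //; last exact: cvg_cst.
under eq_fun do (under eq_integral do rewrite subrr normr0; rewrite integral0).
exact: cvg_cst.
Qed.

Lemma has_bochner_lim (s : nat -> T -> B) f A :
  (forall n, simple_rv (s n)) -> borel_rv f -> measurable A ->
  (\int[P]_w (`|f w - s n w|)%:E)%E @[n --> \oo] --> 0%E ->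
  has_bochner_integral P A f (limn (fun n => simple_integral P A (s n))).
Proof.
move=> ss bf mA cs; split=> //; exists s; split=> //; last first.
  exact: simple_integral_cvg cs.
apply: squeeze_cvge (cvg_cst 0%E) cs; apply: nearW => n.
have [bn _] := ss n.
by rewrite integral_sub_le// integral_ge0// => w _; rewrite lee_fin.
Qed.

Lemma simple_approximation f : borel_rv f -> (Lp_dist P 1 f (cst 0%R) < +oo)%E ->
  exists2 s : nat -> T -> B, forall n, simple_rv (s n) &
  (\int[P]_w (`|f w - s n w|)%:E)%E @[n --> \oo] --> 0%E.
Proof.
move=> bf f1; have [x dx] := separable_sequence sepB.
exists (fun n => nearest x n \o f); first by move=> n; exact: nearest_simple_rv.
have := Lp_nearest_cvg sepB (lexx 1) dx bf f1.
by under eq_fun do rewrite Lp_dist1.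
Qed.

Lemma simple_integral_fibres (K : choiceType) (a : T -> K) A s :
  finite_label a -> measurable A -> simple_rv s ->
  simple_integral P A s =
  \sum_(k <- fset_set (range a)) simple_integral P (A `&` a @^-1` [set k]) s.
Proof.
move=> la mA ss; have [bs fs] := ss.
rewrite /simple_integral; under [RHS]eq_bigr do rewrite fsbig_finite//.
rewrite exchange_big fsbig_finite//=; apply: eq_bigr => b _.
rewrite -scaler_suml (measure_fibres P la); last first.
  by apply: measurableI => //; apply: borel_rv_preimage => //; exact: borel_set1.
by congr (_ *: _); apply: eq_bigr => k _; rewrite setIAC.
Qed.

Lemma simple_integral_null A s : measurable A -> simple_rv s -> P A = 0%E ->
  simple_integral P A s = 0.
Proof.
move=> mA [bs _] A0; apply: fsbig1 => b _.
have -> : P (A `&` s @^-1` [set b]) = 0%E.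
  apply/eqP; rewrite eq_le measure_ge0 andbT -A0; apply: le_measure.
  - by rewrite inE; apply: measurableI => //; apply: borel_rv_preimage => //;
      exact: borel_set1.
  - by rewrite inE.
  - exact: subIsetl.
by rewrite scale0r.
Qed.

(** The conditional expectation is the average of f over each fibre. On a null
    fibre the average is read as 0, and both integrals vanish. *)
Lemma cond_exp_exists (K : choiceType) (a : T -> K) f :
  finite_label a -> borel_rv f -> (Lp_dist P 1 f (cst 0%R) < +oo)%E ->
  exists Z, is_cond_exp P (saturated a) f Z.
Proof.
move=> la bf f1; have [fa ma] := la.
have [s ss cs] := simple_approximation bf f1.
pose v A := limn (fun n => simple_integral P A (s n)).
have cv A : measurable A -> simple_integral P A (s n) @[n --> \oo] --> v A.
  by move=> mA; exact: simple_integral_cvg cs.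
pose z k := (fine (P (a @^-1` [set k])))^-1 *: v (a @^-1` [set k]).
exists (z \o a); split.
  by move=> _ [U _ <-]; rewrite setTI => w w' /= ->.
move=> A sA; have mA := ma _ sA; exists (v A); first exact: has_bochner_lim.
suff -> : v A = simple_integral P A (z \o a).
  by apply: has_bochner_simple; exact: finite_label_simple.
rewrite (simple_integral_label P z la mA); apply/cvg_lim => //.
under eq_fun do rewrite (simple_integral_fibres la mA (ss _)).
apply: cvg_big; first exact: add_continuous.
move=> k _; have mk := measurable_fibre k la.
have mAk : measurable (A `&` a @^-1` [set k]) by exact: measurableI.
have [/eqP Pk0|Pk0] := boolP (P (A `&` a @^-1` [set k]) == 0%E).
  rewrite Pk0 scale0r; under eq_fun do rewrite simple_integral_null//.
  exact: cvg_cst.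
have Ak : A `&` a @^-1` [set k] = a @^-1` [set k].
  apply/seteqP; split=> w; first by case.
  move=> awk; split=> //; apply: contraPP Pk0 => nAw; apply/negP; rewrite negbK.
  rewrite (_ : _ `&` _ = set0) ?measure0//; apply/seteqP; split=> w' // -[Aw' aw'].
  by apply: nAw; apply: sA Aw'; rewrite aw'.
rewrite Ak in Pk0 *; rewrite /z scalerA divff ?scale1r; first exact: cv.
by rewrite fine_eq0// fin_num_measure.
Qed.

End bochner_existence.

(** * Approximation by maps of a finite stage of a filtration *)

Section approximation_in_a_filtration.
Context {d : measure_display} {T : measurableType d} {R : realType}.
Context (P : probability T R).
Variable G : nat -> set (set T).
Hypothesis sigmaG : forall n, sigma_algebra setT (G n).
Hypothesis measurableG : forall n, G n `<=` measurable.
Hypothesis incrG : forall n, G n `<=` G n.+1.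

Lemma filtration_le m n : (m <= n)%N -> G m `<=` G n.
Proof.
elim: n => [|n IH]; first by rewrite leqn0 => /eqP ->.
rewrite leq_eqVlt => /predU1P[->//|]; rewrite ltnS => /IH Gmn.
exact: subset_trans (@incrG n).
Qed.

Lemma measure_lt_setU (S A A' : set T) (e : R) : measurable S ->
  measurable A -> measurable A' -> S `<=` A `|` A' ->
  (P A < (e / 2)%:E)%E -> (P A' < (e / 2)%:E)%E -> (P S < e%:E)%E.
Proof.
move=> mS mA mA' SAA' PA PA'.
apply: (@le_lt_trans _ _ (P (A `|` A'))).
  by apply: le_measure; rewrite ?inE//; exact: measurableU.
apply: le_lt_trans (measureU2 P mA mA') _.
by rewrite [e]splitr EFinD lteD.
Qed.

Definition approximable (A : set T) : Prop :=
  measurable A /\ forall e : R, 0 < e ->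
    exists n, exists2 A', G n A' & (P (A `+` A') < e%:E)%E.

Lemma measurable_setY (A A' : set T) :
  measurable A -> measurable A' -> measurable (A `+` A').
Proof. by move=> mA mA'; apply: measurableU; apply: measurableD. Qed.

(** The union of approximants lies at the later of the two stages, and the
    symmetric difference of unions is covered by the two differences. *)
Lemma approximableU (A A' : set T) :
  approximable A -> approximable A' -> approximable (A `|` A').
Proof.
move=> [mA apA] [mA' apA']; split=> [|e e0]; first exact: measurableU.
have e2 : 0 < e / 2 by rewrite divr_gt0.
have [n [C GC PC]] := apA _ e2; have [n' [C' GC' PC']] := apA' _ e2.
have mC := measurableG GC; have mC' := measurableG GC'.
exists (maxn n n'), (C `|` C').
  apply: sigma_algebraU => //.
    exact: (filtration_le (leq_maxl n n')).
  exact: (filtration_le (leq_maxr n n')).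
apply: measure_lt_setU PC PC'.
- by apply: measurable_setY; exact: measurableU.
- exact: measurable_setY.
- exact: measurable_setY.
- move=> w [[[Aw|A'w] /not_orP[nC nC']]|[[Cw|C'w] /not_orP[nA nA']]].
  + by left; left.
  + by right; left.
  + by left; right.
  + by right; right.
Qed.

Lemma tail_union_small (F : nat -> set T) (e : R) :
  (forall n, measurable (F n)) -> 0 < e ->
  exists N, (P (\bigcup_k F k `\` \big[setU/set0]_(i < N) F i) < e%:E)%E.
Proof.
move=> mF e0; pose V N := \bigcup_k F k `\` \big[setU/set0]_(i < N) F i.
have mV N : measurable (V N).
  by apply: measurableD; [exact: bigcupT_measurable|exact: bigsetU_measurable].
have V0 : \bigcap_N V N = set0.
  apply/seteqP; split=> w // Vw; have [[k _ Fkw] _] := Vw 0%N I.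
  have [_] := Vw k.+1 I; apply; rewrite -bigcup_mkord.
  by exists k => //=.
have : (P \o V) N @[N --> \oo] --> P (\bigcap_N V N).
  apply: nonincreasing_cvg_mu => //.
  - by rewrite -ge0_fin_numE// fin_num_measure.
  - by rewrite V0.
  - move=> n m nm; apply/subsetPset => w [Fw nV]; split=> // Vn; apply: nV.
    move: Vn; rewrite -!bigcup_mkord => -[k /= kn Fk]; exists k => //=.
    exact: leq_trans kn nm.
rewrite V0 measure0 => /(cvge0_nnegP (fun n => measure_ge0 P (V n))).
by move=> /(_ _ e0)[N _ /(_ N (leqnn N))]; exists N.
Qed.

(** Complements have the same symmetric difference, and a countable union is
    close in measure to a finite one, to which [approximableU] applies. *)
Lemma sigma_algebra_approximable : sigma_algebra setT approximable.
Proof.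
split.
- split=> // e e0; exists 0%N, set0; first by case: (sigmaG 0).
  by rewrite setYK measure0.
- move=> A [mA apA]; rewrite setTD; split=> [|e /apA[n [C GC PC]]].
    exact: measurableC.
  exists n, (~` C); first exact: sigma_algebraC.
  rewrite (_ : _ `+` _ = A `+` C)//; apply/seteqP.
  split=> w [[h1 h2]|[h1 h2]].
  + by right; split=> //; apply: contrapT.
  + by left; split=> //; apply: contrapT.
  + by right; split=> //; exact.
  + by left; split=> //; exact.
- move=> F apF; have mF n : measurable (F n) by have [] := apF n.
  split=> [|e e0]; first exact: bigcupT_measurable.
  have e2 : 0 < e / 2 by rewrite divr_gt0.
  have [N PN] := tail_union_small mF e2.
  have [mU apU] : approximable (\big[setU/set0]_(i < N) F i).
    apply: big_ind => [|A A'|i _]; last exact: apF.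
    - split=> // e' e'0; exists 0%N, set0; first by case: (sigmaG 0).
      by rewrite setYK measure0.
    - exact: approximableU.
  have [n [C GC PC]] := apU _ e2; exists n, C => //.
  have mC := measurableG GC.
  apply: measure_lt_setU PN PC.
  + by apply: measurable_setY => //; exact: bigcupT_measurable.
  + by apply: measurableD => //; exact: bigcupT_measurable.
  + exact: measurable_setY.
  + move=> w [[Fw nC]|[Cw nF]].
      have [Uw|nU] := pselect ((\big[setU/set0]_(i < N) F i) w).
        by right; left.
      by left.
    by right; right; split=> // Uw; apply: nF; exact: bigsetU_bigcup Uw.
Qed.

Lemma limit_sigma_algebra_approximable :
  <<s \bigcup_n G n >> `<=` approximable.
Proof.
apply: smallest_sub; first exact: sigma_algebra_approximable.
move=> A [n _ GA]; split=> [|e e0]; first exact: (measurableG GA).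
by exists n, A; rewrite // setYK measure0.
Qed.

Context {B : completeNormedModType R}.

(** Induction on the list of values: each new value b is imposed on a set of a
    finite stage close to the level set of b, the previous map being kept
    elsewhere. The error event only counts
    values that have already been listed. *)
Lemma simple_approx_measure (g : T -> B) (l : seq B) (e : R) :
  simple_rv g -> sigma_rv g `<=` <<s \bigcup_n G n >> -> 0 < e ->
  exists n, exists S : T -> B,
    [/\ measurable_wrt (G n) S, forall w, S w \in 0 :: l &
      (P [set w | g w \in l /\ g w <> S w] < e%:E)%E].
Proof.
move=> sg gG; elim: l e => [|b l IH] e e0.
  exists 0%N, (cst 0); split=> [|w|].
  - by move=> _ [U _ <-]; rewrite setTI preimage_cst; case: ifP => _;
      [rewrite -setC0; apply: sigma_algebraC|]; have [] := sigmaG 0.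
  - by rewrite inE.
  - by rewrite (_ : [set w | _] = set0) ?measure0//; apply/seteqP; split=> w // [].
have e2 : 0 < e / 2 by rewrite divr_gt0.
have [n [S [mS Sl PS]]] := IH _ e2.
have Ab : <<s \bigcup_n G n >> (g @^-1` [set b]).
  by apply: gG; exists [set b]; rewrite ?setTI//; exact: borel_set1.
have [mA apA] := limit_sigma_algebra_approximable Ab.
have [n' [C GC PC]] := apA _ e2.
pose S' w := if w \in C then b else S w.
pose m := maxn n n'.
have GmC : G m C by exact: (filtration_le (leq_maxr n n')).
have mS' : measurable_wrt (G m) S'.
  move=> _ [U bU <-]; rewrite setTI.
  have -> : S' @^-1` U = (C `&` cst b @^-1` U) `|` (~` C `&` S @^-1` U).
    apply/seteqP; split=> w; rewrite /= /S'; case: ifPn; rewrite ?inE ?notin_setE.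
    - by move=> Cw Ub; left.
    - by move=> nC Ub; right.
    - by move=> Cw [[]|[]].
    - by move=> Cw [[]|[]].
  apply: sigma_algebraU => //; apply: sigma_algebraI => //.
  - rewrite preimage_cst; have [G0 GC0 _] := sigmaG m.
    by case: ifP => // _; rewrite -[setT]setD0; exact: GC0.
  - exact: sigma_algebraC.
  - apply: (filtration_le (leq_maxl n n')).
    by apply: mS; exists U; rewrite ?setTI.
exists m, S'; split=> // [w|].
  rewrite /S'; case: ifP => _; first by rewrite !inE eqxx orbT.
  by have := Sl w; rewrite !inE => /orP[->//|->]; rewrite !orbT.
have simple_of (S0 : T -> B) k (l0 : seq B) : measurable_wrt (G k) S0 ->
    (forall w, S0 w \in l0) -> simple_rv S0.
  move=> mS0 S0l; split; first exact: subset_trans (@measurableG k).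
  by apply: sub_finite_set (finite_seq l0) => _ [w _ <-]; exact: S0l.
have sS := simple_of _ _ _ mS Sl.
have sS' : simple_rv S'.
  apply: (simple_of _ m (b :: 0 :: l)) => // w; rewrite /S'.
  by case: ifP => _; rewrite inE ?eqxx// Sl orbT.
apply: measure_lt_setU PC PS.
- exact: (measurable_simple_pair (fun y z => y \in b :: l /\ y <> z)).
- by apply: measurable_setY => //; exact: measurableG GC.
- exact: (measurable_simple_pair (fun y z => y \in l /\ y <> z)).
- move=> w /= []; rewrite /S'; case: ifPn; rewrite ?inE ?notin_setE => Cw gl gS.
    by left; right.
  move: gl => /orP[/eqP gb|gl]; first by left; left.
  by right.
Qed.

End approximation_in_a_filtration.

Section Lp_density.
Context {d : measure_display} {T : measurableType d} {R : realType}.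
Context (P : probability T R) {B : completeNormedModType R}.
Hypothesis sepB : separable_space B.
Variable G : nat -> set (set T).
Hypothesis sigmaG : forall n, sigma_algebra setT (G n).
Hypothesis measurableG : forall n, G n `<=` measurable.
Hypothesis incrG : forall n, G n `<=` G n.+1.

(** The p-th power of the distance is at most M ^ p where g and S differ, and 0
    elsewhere. *)
Lemma Lp_dist_bounded (p M : R) (g S : T -> B) : 0 < p -> 0 <= M ->
  simple_rv g -> simple_rv S -> (forall w, `|g w - S w| <= M) ->
  (Lp_dist P p g S <= (M `^ p)%:E * P [set w | g w <> S w])%E.
Proof.
move=> p0 M0 sg sS gSM; set N := [set w | _].
have mN : measurable N := measurable_simple_pair (fun y z => y <> z) sg sS.
have [bg _] := sg; have [bS _] := sS.
rewrite -[N]setIT -(integral_indic P measurableT mN).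
rewrite -ge0_integralZl_EFin ?powR_ge0//; last first.
  by apply/measurable_EFinP; exact: measurable_indic.
apply: ge0_le_integral => //.
- exact: measurable_normB_powR.
- by apply: measurable_funeM; apply/measurable_EFinP; exact: measurable_indic.
- move=> w _; rewrite -EFinM lee_fin indicE.
  case: (pselect (g w = S w)) => [gS|gS].
    rewrite gS subrr normr0 powR0 ?mulr_ge0 ?powR_ge0//; lra.
  by rewrite mem_set// mulr1 ge0_ler_powR ?nnegrE//; lra.
Qed.

Lemma norm_le_sum_values (g : T -> B) (l : seq B) :
  (forall w, g w \in l) -> forall w, `|g w| <= \sum_(b <- l) `|b|.
Proof.
move=> gl w; rewrite (big_rem (g w))//= lerDl; exact: sumr_ge0.
Qed.

(** Replace f by its nearest point among finitely many, which is again
    measurable for the limit sigma-algebra, and then this simple map by one of a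
    finite stage that differs from it on a set of small measure. *)
Lemma Lp_dense (p : R) (f : T -> B) (e : R) : 1 <= p ->
  borel_rv f -> sigma_rv f `<=` <<s \bigcup_n G n >> ->
  (Lp_dist P p f (cst 0%R) < +oo)%E -> 0 < e ->
  exists n, exists S : T -> B,
    [/\ simple_rv S, measurable_wrt (G n) S & (Lp_dist P p f S < e%:E)%E].
Proof.
move=> p1 bf fG fp e0; have p0 : 0 < p by lra.
pose K := 2 `^ p : R; have K0 : 0 < K by rewrite powR_gt0.
(* the quasi-triangle inequality doubles e1 and multiplies it by K *)
pose e1 := e / K / 2; have e10 : 0 < e1 by rewrite !divr_gt0.
have [x dx] := separable_sequence sepB.
have /(cvge0_nnegP (fun n => Lp_dist_ge0 P p f _))/(_ _ e10)[N _ /(_ N (leqnn N))] :=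
  Lp_nearest_cvg sepB p1 dx bf fp.
set g := nearest x N \o f => fg.
have sg : simple_rv g := nearest_simple_rv sepB x N bf.
have gG : sigma_rv g `<=` <<s \bigcup_n G n >>.
  by apply: subset_trans fG; exact: nearest_sigma_rv.
have [bg fing] := sg; pose l : seq B := fset_set (range g).
have gl w : g w \in 0 :: l.
  by rewrite inE in_fset_set// mem_set ?orbT//; exists w.
pose C := \sum_(b <- 0 :: l) `|b|; have C0 : 0 <= C by apply: sumr_ge0.
pose M := C + C; have M0 : 0 <= M by rewrite addr_ge0.
have Mp0 : 0 < M `^ p + 1 by rewrite ltr_wpDl ?powR_ge0.
have [n [S [mS Sl PS]]] := simple_approx_measure P sigmaG measurableG incrG l sg gG
  (divr_gt0 e10 Mp0).
have sS : simple_rv S.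
  split; first exact: subset_trans (@measurableG n).
  by apply: sub_finite_set (finite_seq (0 :: l)) => _ [w _ <-]; exact: Sl.
have [bS _] := sS; exists n, S; split=> //.
have gS : (Lp_dist P p g S < e1%:E)%E.
  have gSM w : `|g w - S w| <= M.
    by apply: le_trans (ler_normB _ _) _; apply: lerD; apply: norm_le_sum_values.
  apply: le_lt_trans (Lp_dist_bounded p0 M0 sg sS gSM) _.
  have -> : [set w | g w <> S w] = [set w | g w \in l /\ g w <> S w].
    apply/seteqP; split=> w /=; last by case.
    by split=> //; rewrite in_fset_set// mem_set//; exists w.
  set Q := P _ in PS *; have finQ : Q \is a fin_num.
    apply: fin_num_measure.
    exact: (measurable_simple_pair (fun y z => y \in l /\ y <> z)).
  move: PS; rewrite -(fineK finQ) -EFinM !lte_fin ltr_pdivlMr// mulrC => PS.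
  apply: le_lt_trans PS; rewrite ler_wpM2r ?fine_ge0 ?measure_ge0//; lra.
apply: le_lt_trans (Lp_dist_triangle P sepB (ltW p0) bf bg bS) _.
rewrite (_ : e = K * (e1 + e1)); last by rewrite /e1 -splitr mulrC divfK ?gt_eqF.
by rewrite EFinM EFinD lte_pmul2l ?lteD// lte_fin.
Qed.

End Lp_density.

(** * Conditional expectation contracts means *)

Section jensen.
Context {d : measure_display} {T : measurableType d} {R : realType}.
Context (P : probability T R).

(** Convexity of the power function, as the tangent line at c; for p > 1 it is
    Young's inequality applied to u and c ^ (p - 1). *)
Lemma powR_tangent (p c u : R) : 1 <= p -> 0 <= c -> 0 <= u ->
  p * c `^ (p - 1) * u <= u `^ p + (p - 1) * c `^ p.
Proof.
move=> p1 c0 u0; have [->|pn1] := eqVneq p 1.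
  by rewrite subrr powRr0 !mul1r mul0r addr0 powRr1.
have p1' : 0 < p - 1 by rewrite subr_gt0 lt_neqAle eq_sym pn1.
have p0 : 0 < p by lra.
have q0 : 0 < p / (p - 1) by rewrite divr_gt0.
have pq : p^-1 + (p / (p - 1))^-1 = 1.
  by rewrite invf_div -[X in X + _]mul1r -mulrDl addrCA subrr addr0 divff ?gt_eqF.
have := conjugate_powR u0 (powR_ge0 c (p - 1)) p0 q0 pq.
rewrite -powRrM (_ : (p - 1) * (p / (p - 1)) = p); last first.
  by rewrite mulrC divfK ?gt_eqF.
move=> /(ler_wpM2l (ltW p0)); rewrite invf_div.
have -> : p * (u * c `^ (p - 1)) = p * c `^ (p - 1) * u by ring.
have -> // : p * (u `^ p / p + c `^ p * ((p - 1) / p)) = u `^ p + (p - 1) * c `^ p.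
by field; rewrite gt_eqF.
Qed.

(** Jensen's inequality for the power function, obtained by integrating the
    tangent line at the constant. *)
Lemma jensen_powR (A : set T) (phi : T -> R) (p c : R) : 1 <= p -> 0 <= c ->
  measurable A -> measurable_fun setT phi -> (forall w, 0 <= phi w) ->
  (c%:E * P A <= \int[P]_(w in A) (phi w)%:E)%E ->
  ((c `^ p)%:E * P A <= \int[P]_(w in A) (phi w `^ p)%:E)%E.
Proof.
move=> p1 c0 mA mphi phi0 le1; have p0 : 0 < p by lra.
have mphiA : measurable_fun A (EFin \o phi).
  by apply: measurable_funTS; exact/measurable_EFinP.
have mphip : measurable_fun A (fun w => (phi w `^ p)%:E).
  apply: measurable_funTS; apply/measurable_EFinP.
  exact: (measurableT_comp (measurable_powR p)).
set I := (\int[P]_(w in A) (phi w `^ p)%:E)%E.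
have I0 : (0 <= I)%E by apply: integral_ge0 => w _; rewrite lee_fin powR_ge0.
have [c00|cn0] := eqVneq c 0; first by rewrite c00 powR0 ?gt_eqF// mul0e.
have ccE : c `^ (p - 1) * c = c `^ p.
  rewrite -[X in _ * X]powRr1// -powRD; first by congr powR; lra.
  by rewrite cn0 implybT.
have finA : P A \is a fin_num by apply: fin_num_measure.
have K0 : 0 <= p * c `^ (p - 1) by rewrite mulr_ge0 ?powR_ge0 ?ltW.
have K1 : 0 <= (p - 1) * c `^ p by rewrite mulr_ge0 ?powR_ge0// subr_ge0.
have le2 : ((p * c `^ p)%:E * P A <= I + ((p - 1) * c `^ p)%:E * P A)%E.
  rewrite -ccE mulrA EFinM -muleA.
  apply: (@le_trans _ _ (\int[P]_(w in A) ((p * c `^ (p - 1))%:E * (phi w)%:E))%E).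
    rewrite ge0_integralZl_EFin//; last by move=> w _; rewrite lee_fin.
    by apply: lee_pmul => //; rewrite ?lee_fin// mule_ge0// lee_fin.
  rewrite -(integral_cst P mA) -ge0_integralD//; last 2 first.
  - by move=> w _; rewrite lee_fin powR_ge0.
  - by move=> w _; rewrite /= lee_fin ccE.
  apply: ge0_le_integral => //.
  - move=> w _; rewrite -EFinM lee_fin. by apply: mulr_ge0.
  - exact: measurable_funeM.
  - by apply: emeasurable_funD.
  - by move=> w _; rewrite -EFinM -EFinD lee_fin ccE powR_tangent.
move: le2 I0; case: I => [r| |] le2 I0; [|by rewrite leey|by []]; move: le2.
rewrite -(fineK finA) -!EFinM -EFinD !lee_fin; lra.
Qed.

End jensen.

Section conditional_expectation.
Context {d : measure_display} {T : measurableType d} {R : realType}.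
Context (P : probability T R) {B : completeNormedModType R}.
Hypothesis sepB : separable_space B.
Context {K : choiceType}.
Implicit Types (a : T -> K) (f S Z : T -> B) (A : set T).

Lemma saturated_rv_eq a S w w' :
  measurable_wrt (saturated a) S -> a w = a w' -> S w = S w'.
Proof.
move=> mS e; have sS : saturated a (S @^-1` [set S w]).
  by apply: mS; exists [set S w]; rewrite ?setTI//; exact: borel_set1.
by rewrite (sS w w' e).
Qed.

Lemma saturated_rv_factor a S : measurable_wrt (saturated a) S ->
  exists h : K -> B, S = h \o a.
Proof.
move=> mS.
exists (fun k =>
  if pselect (exists w, a w = k) is left e then S (projT1 (cid e)) else 0).
apply/funext => w /=; case: pselect => [e|[]]; last by exists w.
by apply: saturated_rv_eq mS _; exact: (esym (projT2 (cid e))).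
Qed.

Lemma saturated_simple a S : finite_label a -> measurable_wrt (saturated a) S ->
  simple_rv S.
Proof. by move=> la /saturated_rv_factor[h ->]; exact: finite_label_simple. Qed.

Lemma simple_integral_cst A S b : measurable A -> simple_rv S ->
  (forall w, A w -> S w = b) -> simple_integral P A S = fine (P A) *: b.
Proof.
move=> mA sS Sb; have [A0|/set0P[w0 Aw0]] := eqVneq A set0.
  by rewrite simple_integral_null ?A0 ?measure0// scale0r.
have [bS fS] := sS.
rewrite /simple_integral (fsbigD1 b)//=; last by exists w0 => //; exact: Sb.
rewrite fsbig1 => [|b' [_ /= b'b]]; last first.
  rewrite (_ : A `&` _ = set0) ?measure0 ?scale0r//.
  by apply/seteqP; split=> w // [/Sb SE /= Sb']; apply: b'b; rewrite -Sb' SE.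
rewrite addr0; congr (fine (P _) *: _); apply/seteqP; split=> w; first by case.
by move=> Aw; split=> //; exact: Sb.
Qed.

(** On a fibre of the label both Z and S are constant, and the integrals of f
    and Z agree there, so averaging contracts the distance to S. *)
Lemma cond_exp_fibre a f Z S A (z s : B) : finite_label a ->
  is_cond_exp P (saturated a) f Z -> measurable_wrt (saturated a) S ->
  saturated a A -> (forall w, A w -> Z w = z) -> (forall w, A w -> S w = s) ->
  (`|z - s|%:E * P A <= \int[P]_(w in A) (`|f w - S w|)%:E)%E.
Proof.
move=> la [mZ cZ] mS sA Zz Ss; have [_ ma] := la; have mA := ma _ sA.
have sZ := saturated_simple la mZ; have sS := saturated_simple la mS.
have [v fv Zv] := cZ _ sA; have [bf _] := fv.
have := bochner_dist sepB mA fv (has_bochner_simple P A sS).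
have finA : P A \is a fin_num by apply: fin_num_measure.
have vE : v = simple_integral P A Z.
  exact: (bochner_unique sepB mA Zv (has_bochner_simple P A sZ)).
rewrite vE (simple_integral_cst mA sZ Zz) (simple_integral_cst mA sS Ss).
rewrite -scalerBr normrZ ger0_norm ?fine_ge0 ?measure_ge0//.
by rewrite mulrC EFinM fineK.
Qed.

(** The contraction holds on every saturated set separately, not only in
    total; the maximal inequality depends on this. *)
Lemma cond_exp_contraction a f Z S A (p : R) : 1 <= p -> finite_label a ->
  is_cond_exp P (saturated a) f Z -> measurable_wrt (saturated a) S ->
  saturated a A -> borel_rv f ->
  (\int[P]_(w in A) (`|Z w - S w| `^ p)%:E <=
   \int[P]_(w in A) (`|f w - S w| `^ p)%:E)%E.
Proof.
move=> p1 la fZ mS sA bf; have [fa ma] := la; have mA := ma _ sA.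
have [mZ _] := fZ.
have sZ := saturated_simple la mZ; have sS := saturated_simple la mS.
have [bZ _] := sZ; have [bS _] := sS.
have nn (g h : T -> B) w : (0 <= (`|g w - h w| `^ p)%:E)%E.
  by rewrite lee_fin powR_ge0.
rewrite (integral_fibres P la mA (measurable_normB_powR sepB p bZ bS) (nn Z S)).
rewrite (integral_fibres P la mA (measurable_normB_powR sepB p bf bS) (nn f S)).
rewrite big_seq [leRHS]big_seq; apply: lee_sum => k.
rewrite in_fset_set// inE => -[w0 _ <-].
set C := A `&` _.
have sC : saturated a C.
  apply: (sigma_algebraI (sigma_algebra_saturated a)) => //.
  exact: saturated_fibre.
have mC := ma _ sC.
have Zz w : C w -> Z w = Z w0 by move=> [_ aw]; exact: saturated_rv_eq aw.
have Ss w : C w -> S w = S w0 by move=> [_ aw]; exact: saturated_rv_eq aw.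
have -> : (\int[P]_(w in C) (`|Z w - S w| `^ p)%:E =
    (`|Z w0 - S w0| `^ p)%:E * P C)%E.
  rewrite -integral_cst//; apply: eq_integral => w; rewrite inE => Cw.
  by rewrite (Zz w Cw) (Ss w Cw).
apply: jensen_powR => //.
  exact: measurable_normB.
exact: cond_exp_fibre fZ _ _ _ _.
Qed.


Lemma cond_exp_contraction1 a f Z S A : finite_label a ->
  is_cond_exp P (saturated a) f Z -> measurable_wrt (saturated a) S ->
  saturated a A -> borel_rv f ->
  (\int[P]_(w in A) (`|Z w - S w|)%:E <= \int[P]_(w in A) (`|f w - S w|)%:E)%E.
Proof.
move=> la fZ mS sA bf.
have := cond_exp_contraction (lexx 1) la fZ mS sA bf.
have E (g : T -> B) : (\int[P]_(w in A) (`|g w - S w| `^ 1)%:E =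
    \int[P]_(w in A) (`|g w - S w|)%:E)%E.
  by apply: eq_integral => w _; rewrite powRr1.
by rewrite !E.
Qed.

End conditional_expectation.

(** * Levy's upward theorem *)

Section levy.
Context {d : measure_display} {T : measurableType d} {R : realType}.
Context (P : probability T R) {B : completeNormedModType R}.
Hypothesis sepB : separable_space B.

Lemma cst_le_integral (A : set T) (phi : T -> R) (c : R) : measurable A ->
  measurable_fun setT phi -> 0 <= c ->
  (forall w, A w -> c <= phi w) ->
  (c%:E * P A <= \int[P]_(w in A) (phi w)%:E)%E.
Proof.
move=> mA mphi c0 cphi; rewrite -integral_cst//; apply: ge0_le_integral => //.
by apply: measurable_funTS; apply/measurable_EFinP.
Qed.

Lemma negligible_small (N : set T) :
  (forall e : R, 0 < e -> exists W, [/\ measurable W, N `<=` W & (P W <= e%:E)%E]) ->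
  P.-negligible N.
Proof.
move=> small; have /choice[W WP] : forall j : nat, exists W,
    [/\ measurable W, N `<=` W & (P W <= (j.+1%:R^-1 : R)%:E)%E].
  by move=> j; apply: small; rewrite invr_gt0.
exists (\bigcap_j W j); split.
- by apply: bigcapT_measurable => j; have [] := WP j.
- apply/eqP; rewrite eq_le measure_ge0 andbT; apply/lee_addgt0Pr => e e0.
  rewrite add0e; have [j je] : exists j : nat, j.+1%:R^-1 < e.
    by have [j _ /(_ j (leqnn j))] := near_infty_natSinv_lt (PosNum e0); exists j.
  have [mW _ PW] := WP j.
  apply: (@le_trans _ _ (P (W j))).
    apply: le_measure; rewrite ?inE//; last exact: bigcap_inf.
    by apply: bigcapT_measurable => i; have [] := WP i.
  by apply: le_trans PW _; rewrite lee_fin ltW.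
- by move=> w Nw j _; have [_ sub _] := WP j; exact: sub.
Qed.

Context {K : choiceType}.
Variable a : nat -> T -> K.
Hypothesis labela : forall n, finite_label (a n).
Hypothesis incra : forall n, saturated (a n) `<=` saturated (a n.+1).
Variables (f : T -> B) (Z : nat -> T -> B).
Hypothesis bf : borel_rv f.
Hypothesis fZ : forall n, is_cond_exp P (saturated (a n)) f (Z n).

Let satle m n : (m <= n)%N -> saturated (a m) `<=` saturated (a n).
Proof. exact: (filtration_le (G := fun n => saturated (a n))). Qed.

Let mZ n : measurable_wrt (saturated (a n)) (Z n).
Proof. by have [] := fZ n. Qed.

Let sZ n : simple_rv (Z n).
Proof. exact: saturated_simple (labela n) (@mZ n). Qed.

(** Doob's maximal inequality. The times at which the bound is first exceeded
    split the event into disjoint sets, each in a sigma-algebra of the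
    filtration, and the contraction estimate applies on each of them. *)
Lemma maximal_inequality (m : nat) (S : T -> B) (c : R) : 0 <= c ->
  measurable_wrt (saturated (a m)) S ->
  (c%:E * P (\bigcup_i [set w | (c < `|Z (m + i)%N w - S w|)%R]) <=
   Lp_dist P 1 f S)%E.
Proof.
move=> c0 mS; set V := fun i => [set w | c < `|Z (m + i)%N w - S w|].
have sS := saturated_simple (labela m) mS; have [bS _] := sS.
have satV i j : (i <= j)%N -> saturated (a (m + j)%N) (V i).
  move=> ij w w' e; rewrite /V /=.
  have -> : Z (m + i)%N w = Z (m + i)%N w'.
    apply: saturated_rv_eq e; apply: subset_trans (@mZ (m + i)%N) _.
    by apply: satle; rewrite leq_add2l.
  have -> // : S w = S w'.
  apply: saturated_rv_eq e; apply: subset_trans mS _.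
  by apply: satle; exact: leq_addr.
have satD i : saturated (a (m + i)%N) (seqDU V i).
  have sA := sigma_algebra_saturated (a (m + i)%N).
  rewrite /seqDU setDE; apply: (sigma_algebraI sA); first exact: satV.
  apply: (sigma_algebraC sA).
  rewrite -bigcup_mkord; apply: (sigma_algebra_fin_bigcup sA).
    exact: finite_II.
  by move=> j /= /ltnW ji; exact: satV.
have mD i : measurable (seqDU V i).
  by have [_ sub] := labela (m + i); exact: sub.
have mfS := measurable_normB sepB bf bS.
have mU : measurable (\bigcup_i V i).
  by rewrite seqDU_bigcup_eq; exact: bigcupT_measurable.
rewrite Lp_dist1.
apply: (@le_trans _ _
  (\int[P]_(w in \bigcup_i V i) (`|f w - S w|)%:E)%E); last first.
  by apply: ge0_subset_integral => //; exact: measurable_EnormB.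
rewrite -integral_cst// seqDU_bigcup_eq.
rewrite !ge0_integral_bigcup//; last first.
  by apply: measurable_funTS; exact: measurable_EnormB.
apply: lee_nneseries => [i _ _|i _].
  by apply: integral_ge0 => w _; rewrite lee_fin.
rewrite integral_cst//.
have [bZ _] := sZ (m + i)%N.
apply: le_trans (cst_le_integral (mD i) (measurable_normB sepB bZ bS) c0 _) _.
  by move=> w [Vw _]; exact: ltW.
apply: cond_exp_contraction1 (fZ (m + i)%N) _ _ _ => //.
by apply: subset_trans mS _; apply: satle; exact: leq_addr.
Qed.

Hypothesis fG : sigma_rv f `<=` <<s \bigcup_n saturated (a n) >>.

Let dense_f p e := @Lp_dense _ _ _ P _ sepB (fun n => saturated (a n))
  (fun n => sigma_algebra_saturated (a n)) (fun n => (labela n).2) incra p f e.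

(** Replace f by a map S of a finite stage that is close in mean: Z n - S is
    controlled uniformly in n by the maximal inequality, f - S by Markov's
    inequality, and S itself has stopped moving. *)
Lemma deviation_small (c e : R) : 0 < c -> 0 < e ->
  (Lp_dist P 1 f (cst 0%R) < +oo)%E ->
  exists W, [/\ measurable W,
    [set w | ~ \forall n \near \oo, `|f w - Z n w| <= c] `<=` W &
    (P W <= e%:E)%E].
Proof.
move=> c0 e0 f1; pose c2 := c / 2; have c20 : 0 < c2 by rewrite divr_gt0.
have ec0 : 0 < c2 * (e / 2) by rewrite mulr_gt0// divr_gt0.
have [m [S [sS mS fS]]] := dense_f (lexx 1) bf fG f1 ec0.
have [bS _] := sS.
set V := \bigcup_i [set w | c2 < `|Z (m + i)%N w - S w|].
set V' := [set w | c2 < `|f w - S w|].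
have mV' : measurable V'.
  by apply: measurable_ltr_set => //; exact: measurable_normB.
have mV : measurable V.
  apply: bigcupT_measurable => i; apply: measurable_ltr_set => //.
  by apply: measurable_normB => //; have [] := sZ (m + i)%N.
have half A : measurable A -> (c2%:E * P A <= Lp_dist P 1 f S)%E ->
    (P A <= (e / 2)%:E)%E.
  move=> mA /le_lt_trans/(_ fS); rewrite (EFinM c2) lte_pmul2l//; exact: ltW.
exists (V `|` V'); split; first exact: measurableU.
- move=> w ncvg; apply: contrapT => /not_orP[nV nV']; apply: ncvg.
  exists m => // n /= mn.
  have Zn : `|Z n w - S w| <= c2.
    rewrite leNgt; apply/negP => lt; apply: nV; exists (n - m)%N => //=.
    by rewrite subnKC.
  have fSw : `|f w - S w| <= c2 by rewrite leNgt; apply/negP => fw; exact: nV'.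
  have := ler_distD (S w) (f w) (Z n w); rewrite (distrC (S w)) /c2 in Zn fSw *.
  lra.
- apply: le_trans (measureU2 P mV mV') _; rewrite [e]splitr EFinD.
  apply: leeD; apply: half => //; first exact: (maximal_inequality (ltW c20)).
  have mfS := measurable_normB sepB bf bS.
  have := cst_le_integral mV' mfS (ltW c20) (fun w => @ltW _ _ _ _).
  by rewrite Lp_dist1 => /le_trans; apply; exact: integral_sub_le.
Qed.

Lemma levy_cvg_as : (Lp_dist P 1 f (cst 0%R) < +oo)%E -> cvg_as P Z f.
Proof.
move=> f1; apply: (@negligibleS _ _ _ P
  (\bigcup_k [set w | ~ \forall n \near \oo, `|f w - Z n w| <= k.+1%:R^-1])).
  move=> w /= ncvg; apply: contrapT => nw; apply: ncvg.
  apply/cvgrPdist_lt => e e0.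
  have [k _ /(_ k (leqnn k)) ke] := near_infty_natSinv_lt (PosNum e0).
  have : \forall n \near \oo, `|f w - Z n w| <= k.+1%:R^-1.
    by apply: contrapT => nk; apply: nw; exists k.
  by apply: filterS => n /le_lt_trans; apply.
apply: negligible_bigcup => k; apply: negligible_small => e e0.
by apply: deviation_small => //; rewrite invr_gt0.
Qed.

(** Once S is measurable at stage n, the contraction bounds the distance from
    Z n to S by the distance from f to S. *)
Lemma levy_cvg_Lp p : 1 <= p -> (Lp_dist P p f (cst 0%R) < +oo)%E ->
  Lp_dist P p (Z n) f @[n --> \oo] --> 0%E.
Proof.
move=> p1 fp; apply/(cvge0_nnegP (fun n => Lp_dist_ge0 P p _ _)) => e e0.
pose C := 2 `^ p : R; have C0 : 0 < C by rewrite powR_gt0.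
have e10 : 0 < e / C / 2 by rewrite !divr_gt0.
have [m [S [sS mS fS]]] := dense_f p1 bf fG fp e10.
have [bS _] := sS.
exists m => // n /= mn; have [bZ _] := sZ n.
have p0 : 0 <= p by lra.
apply: le_lt_trans (Lp_dist_triangle P sepB p0 bZ bS bf) _.
rewrite (_ : e = C * (e / C / 2 + e / C / 2)); last first.
  by rewrite -splitr mulrC divfK ?gt_eqF.
rewrite (EFinM C) EFinD lte_pmul2l ?lte_fin//; apply: lteD; last first.
  by rewrite Lp_distC.
apply: le_lt_trans fS; apply: cond_exp_contraction => //.
  exact: subset_trans mS (satle mn).
Qed.

(** The contraction with S = 0. *)
Lemma cond_exp_in_Lp p n : 1 <= p -> in_Lp P p f -> in_Lp P p (Z n).
Proof.
move=> p1; rewrite /in_Lp unlock => -[_ fp]; have [bZ _] := sZ n; split=> //.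
have := cond_exp_contraction sepB p1 (labela n) (fZ n) (S := cst 0) (A := setT)
  _ _ bf.
under eq_integral do rewrite subr0.
under [X in (_ -> _ -> _ <= X)%E]eq_integral do rewrite subr0.
move=> h; apply: le_lt_trans fp; apply: h => //.
move=> _ [U _ <-]; by rewrite setTI preimage_cst; case: ifP => _ w w' _.
Qed.

End levy.

(** * Moments, supports and the tower property *)

Section moments.
Context {d : measure_display} {T : measurableType d} {R : realType}.
Context (P : probability T R) {B : completeNormedModType R}.
Hypothesis sepB : separable_space B.

Lemma in_Lp_dist p (f : T -> B) :
  in_Lp P p f -> (Lp_dist P p f (cst 0%R) < +oo)%E.
Proof.
rewrite /in_Lp unlock => -[_]; rewrite /Lp_dist.
by under [X in (_ -> X < _)%E]eq_integral do rewrite subr0.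
Qed.

(** On a probability space a moment of order p bounds the first moment, since
    u <= 1 + u ^ p. *)
Lemma in_Lp_dist1 p (f : T -> B) : 1 <= p ->
  in_Lp P p f -> (Lp_dist P 1 f (cst 0%R) < +oo)%E.
Proof.
move=> p1 Lf; have [bf _] := Lf; have fp := in_Lp_dist Lf.
have b0 := @borel_rv_cst _ T R B 0.
apply: (@le_lt_trans _ _ (1 + Lp_dist P p f (cst 0%R))%E); last first.
  by rewrite lte_add_pinfty// ltry.
have -> : (1 = \int[P]_w cst 1 w)%E.
  by rewrite integral_cst// mul1e; exact/esym/probability_setT.
rewrite -ge0_integralD//; [|exact: measurable_normB_powR].
apply: ge0_le_integral => //.
- exact: measurable_normB_powR.
- by apply: emeasurable_funD => //; exact: measurable_normB_powR.
- move=> w _; rewrite /= -EFinD lee_fin powRr1//.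
  have := powR_tangent p1 ler01 (normr_ge0 (f w - cst 0 w)).
  have := powR_ge0 (`|f w - cst 0 w|) p.
  rewrite !powR1 !mulr1; have [|] := leP (`|f w - cst 0 w|) 1; nra.
Qed.

Lemma supported_of_label (K : choiceType) (a : T -> K) (D : set K) (Z : T -> B) :
  finite_set D -> range a `<=` D -> measurable_wrt (saturated a) Z ->
  supported_on_at_most P (cardinal D) Z.
Proof.
move=> fD aD /saturated_rv_factor[h ->]; exists (range (h \o a)); split.
  rewrite -(image_comp a h); apply: card_le_trans (card_image_le _ _) _.
  apply: card_le_trans (subset_card_le aD) _.
  have /finite_setP[n Dn] := fD; rewrite /cardinal (card_fset_set Dn).
  by have /card_eqPle[] := Dn.
rewrite /law /pushforward (_ : _ @^-1` _ = setT) ?probability_setT//.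
by apply/seteqP; split=> // w _; exists w.
Qed.

Lemma sigma_rv_generated (f : T -> B) (C : set (set B)) (G : set (set T)) :
  sigma_algebra setT G -> <<s C >> = @borel B ->
  (forall U, C U -> G (f @^-1` U)) -> sigma_rv f `<=` G.
Proof.
move=> [G0 GC GU] gen CG E [U bU <-]; rewrite setTI; move: U bU; rewrite -gen.
apply: (@smallest_sub _ _ _ [set U | G (f @^-1` U)]) => //; split=> //=.
- by move=> A GA; have := GC _ GA.
- by move=> F GF; rewrite preimage_bigcup; exact: GU.
Qed.

Lemma cond_exp_sub (G H : set (set T)) (f Z : T -> B) : H `<=` G ->
  measurable_wrt H Z -> is_cond_exp P G f Z -> is_cond_exp P H f Z.
Proof. by move=> HG mZ [_ cZ]; split=> // A /HG/cZ. Qed.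

(** All four maps have the same integral over a set of L: Y' and Y because L
    is contained in H, Y and X because it is contained in G, X and X' by
    definition. *)
Lemma cond_exp_tower (G H L : set (set T)) (X Y X' Y' : T -> B) :
  L `<=` measurable -> L `<=` G -> L `<=` H ->
  is_cond_exp P G Y X -> is_cond_exp P H Y Y' -> is_cond_exp P L X X' ->
  is_cond_exp P L Y' X'.
Proof.
move=> mL LG LH [_ cYX] [_ cYY'] [mX' cXX']; split=> // A LA.
have mA := mL _ LA.
have [u Yu Xu] := cYX _ (LG _ LA).
have [v Yv Y'v] := cYY' _ (LH _ LA).
have [z Xz X'z] := cXX' _ LA.
exists v => //.
by rewrite (bochner_unique sepB mA Yv Yu) (bochner_unique sepB mA Xu Xz).
Qed.

End moments.

(** * Pairs of finite Borel partitions *)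

Section partitions.
Context {d : measure_display} {T : measurableType d} {R : realType}
  {B : completeNormedModType R}.

Lemma finite_label_block (X : T -> B) (Pi : set (set B)) :
  borel_rv X -> finite_borel_partition Pi -> finite_label (block Pi \o X).
Proof.
move=> bX [bPi fPi pPi]; split; first exact: finite_range_block.
rewrite -sigma_partition//; apply: smallest_sub.
  exact: sigma_algebra_measurable.
by move=> _ [Q PQ <-]; rewrite setTI; apply: borel_rv_preimage => //; exact: bPi.
Qed.

Lemma range_block (X : T -> B) (Pi : set (set B)) :
  finite_borel_partition Pi -> range (block Pi \o X) `<=` Pi.
Proof. by move=> [_ _ pPi] _ [w _ <-]; have [] := block_in (X w) pPi. Qed.

Lemma block_partition_refine (Pi Pi' : set (set B)) x y :
  finite_borel_partition Pi -> finite_borel_partition Pi' ->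
  <<s Pi >> `<=` <<s Pi' >> -> block Pi' x = block Pi' y ->
  block Pi x = block Pi y.
Proof. by move=> [_ fPi pPi] [_ fPi' pPi']; exact: block_refine. Qed.

Lemma cardinal_prod (K L : choiceType) (D : set K) (E : set L) :
  finite_set D -> finite_set E ->
  cardinal (D `*` E) = (cardinal D * cardinal E)%N.
Proof.
move=> fD fE; rewrite /cardinal fset_setX//.
rewrite -[RHS](size_allpairs (fun x y => (x, y))); apply: perm_size.
apply: uniq_perm => [||[x y]]; first exact: fset_uniq.
  by apply: allpairs_uniq => //; [exact: fset_uniq..|move=> [? ?] [? ?]].
rewrite in_fsetM /=; apply/andP/allpairsP => [[xD yE]|[[x' y'] [xD yE [-> ->]]]//].
by exists (x, y).
Qed.

End partitions.

Theorem theorem6 (R : realType) (d : measure_display) (T : measurableType d)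
    (P : probability T R) (B : completeNormedModType R)
    (sepB : separable_space B)
    (Pi1 Pi2 : nat -> set (set B))
    (part1 : forall n, finite_borel_partition (Pi1 n))
    (part2 : forall n, finite_borel_partition (Pi2 n))
    (gen1 : <<s \bigcup_n Pi1 n >> = @borel B)
    (gen2 : <<s \bigcup_n Pi2 n >> = @borel B)
    (refine1 : forall n, <<s Pi1 n >> `<=` <<s Pi1 n.+1 >>)
    (refine2 : forall n, <<s Pi2 n >> `<=` <<s Pi2 n.+1 >>)
    (p : R) (hp : 1 <= p)
    (X Y : T -> B) (LpX : in_Lp P p X) (LpY : in_Lp P p Y)
    (martXY : is_cond_exp P (sigma_rv X) Y X) :
  let sX := fun n => <<s preimage_set_system setT X (Pi1 n) >> in
  let sXY := fun n =>
    sigma_join <<s preimage_set_system setT X (Pi1 n) >>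
               <<s preimage_set_system setT Y (Pi2 n) >> in
  (forall n, (exists Z, is_cond_exp P (sX n) X Z) /\
             (exists Z, is_cond_exp P (sXY n) Y Z)) /\
  forall Xn Yn : nat -> T -> B,
    (forall n, is_cond_exp P (sX n) X (Xn n)) ->
    (forall n, is_cond_exp P (sXY n) Y (Yn n)) ->
    (forall n,
      supported_on_at_most P (cardinal (Pi1 n)) (Xn n) /\
      supported_on_at_most P
        (cardinal (Pi1 n) * cardinal (Pi2 n))%N (Yn n) /\
      is_cond_exp P (sX n) (Yn n) (Xn n) /\
      is_cond_exp P (sigma_rv (Xn n)) (Yn n) (Xn n) /\
      is_cond_exp P (sigma_rv (Xn n)) X (Xn n) /\
      is_cond_exp P (sigma_rv (Yn n)) Y (Yn n)) /\
    cvg_as P Xn X /\ cvg_Lp P p Xn X /\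
    cvg_as P Yn Y /\ cvg_Lp P p Yn Y.
Proof.
move=> sX sXY.
have [bX _] := LpX; have [bY _] := LpY.
have X1 := in_Lp_dist1 sepB hp LpX; have Y1 := in_Lp_dist1 sepB hp LpY.
pose a1 n := block (Pi1 n) \o X.
pose a2 n := block (Pi2 n) \o Y.
pose a12 n w := (a1 n w, a2 n w).
have l1 n : finite_label (a1 n) by exact: finite_label_block.
have l2 n : finite_label (a2 n) by exact: finite_label_block.
have l12 n : finite_label (a12 n) by exact: finite_label_pair.
have sXE n : sX n = saturated (a1 n).
  by have [_ fPi pPi] := part1 n; exact: sigma_partition.
have sXYE n : sXY n = saturated (a12 n).
  have [_ fPi pPi] := part2 n; have [fa1 _] := l1 n; have [fa2 _] := l2 n.
  by rewrite -sigma_join_saturated// -sXE -(sigma_partition Y pPi fPi).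
have incr1 n : saturated (a1 n) `<=` saturated (a1 n.+1).
  move=> A sA w w' e; apply: sA.
  exact: block_partition_refine (refine1 n) e.
have incr12 n : saturated (a12 n) `<=` saturated (a12 n.+1).
  move=> A sA w w' [e1 e2]; apply: sA; congr pair.
    exact: block_partition_refine (refine1 n) e1.
  exact: block_partition_refine (refine2 n) e2.
have genX : sigma_rv X `<=` <<s \bigcup_n saturated (a1 n) >>.
  apply: sigma_rv_generated gen1 _; first exact: smallest_sigma_algebra.
  move=> Q [n _ PQ]; apply: sub_gen_smallest; exists n => //.
  by have [_ _ pPi] := part1 n; apply: saturated_comp; exact: saturated_block.
have genY : sigma_rv Y `<=` <<s \bigcup_n saturated (a12 n) >>.
  apply: sigma_rv_generated gen2 _; first exact: smallest_sigma_algebra.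
  move=> Q [n _ PQ]; apply: sub_gen_smallest; exists n => // w w' [_ e].
  have [_ _ pPi] := part2 n.
  exact: (saturated_comp (X := Y) (saturated_block pPi PQ)) e.
(* the martingale property is given on the sigma-algebra of X *)
have sXX n : sX n `<=` sigma_rv X.
  move=> A; rewrite sXE => sA.
  have [bPi fPi pPi] := part1 n.
  have : <<s preimage_set_system setT X (Pi1 n) >> A by rewrite sigma_partition.
  apply: smallest_sub; last first.
    by move=> _ [Q PQ <-]; exists Q => //; exact: bPi.
  apply: sigma_algebra_preimage; exact: smallest_sigma_algebra.
have sXsXY n : sX n `<=` sXY n.
  by rewrite sXE sXYE => A sA w w' [e _]; exact: sA e.
split=> [n|Xn Yn cX cY].
  split; first by rewrite sXE; exact: cond_exp_exists.
  by rewrite sXYE; exact: cond_exp_exists.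
have cX' n : is_cond_exp P (saturated (a1 n)) X (Xn n) by rewrite -sXE.
have cY' n : is_cond_exp P (saturated (a12 n)) Y (Yn n) by rewrite -sXYE.
split=> [n|].
  have [mXn _] := cX' n; have [mYn _] := cY' n.
  have cYX : is_cond_exp P (sX n) (Yn n) (Xn n).
    apply: cond_exp_tower martXY (cY n) (cX n) => //.
    by rewrite sXE; have [] := l1 n.
  have sub : sigma_rv (Xn n) `<=` sX n by have [] := cX n.
  have [_ fPi1 _] := part1 n; have [_ fPi2 _] := part2 n.
  split; first by apply: supported_of_label mXn => //; exact: range_block.
  split.
    rewrite -cardinal_prod//; apply: supported_of_label mYn; first exact: finite_setX.
    move=> _ [w _ <-]; split.
      by apply: (@range_block _ _ _ _ X _ (part1 n)); exists w.
    by apply: (@range_block _ _ _ _ Y _ (part2 n)); exists w.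
  split=> //.
  split; first exact: cond_exp_sub sub _ cYX.
  split; first exact: cond_exp_sub sub _ (cX n).
  by apply: cond_exp_sub _ _ (cY n) => //; have [] := cY n.
split; first exact: (levy_cvg_as sepB l1 incr1 bX cX' genX X1).
split.
  split; first by move=> n; exact: (cond_exp_in_Lp sepB l1 bX cX' n hp LpX).
  have := levy_cvg_Lp sepB l1 incr1 bX cX' genX hp (in_Lp_dist LpX).
  by rewrite unlock.
split; first exact: (levy_cvg_as sepB l12 incr12 bY cY' genY Y1).
split; first by move=> n; exact: (cond_exp_in_Lp sepB l12 bY cY' n hp LpY).
have := levy_cvg_Lp sepB l12 incr12 bY cY' genY hp (in_Lp_dist LpY).
by rewrite unlock.
Qed.
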